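(* Let $t\ge 1$ be an integer and let $I=B_t(u)\subset S=K[x_1,\dots,x_n]$ be the $t$-spread principal Borel ideal generated by the $t$-spread monomial $u=x_{i_1}\cdots x_{i_d}$, where $t+1\le i_1<i_2<\cdots<i_{d-1}<i_d=n$. Then $$\operatorname{depth}\frac{S}{I^k}=0\quad\text{for } k\ge d.$$ In particular, the analytic spread of $I$ is $\ell(I)=n$.
   Context: $K$ is a field, $S=K[x_1,\dots,x_n]$, $\mathfrak m=(x_1,\dots,x_n)$. For a monomial $w$, $\operatorname{supp}(w)=\{j: x_j\mid w\}$; for a monomial ideal $I$, $G(I)$ denotes its unique minimal set of monomial generators. The depth is taken with respect to $\mathfrak m$. The analytic spread $\ell(I)$ of a graded ideal $I\subset S$ is the Krull dimension of the fiber ring $\mathcal{R}(I)/\mathfrak m\mathcal{R}(I)$, where $\mathcal{R}(I)=\bigoplus_{j\ge0}I^jy^j\subset S[y]$ is the Rees algebra of $I$. For an integer $t\ge 1$, a monomial $x_{i_1}\cdots x_{i_d}\in S$ with $i_1\le\cdots\le i_d$ is called $t$-spread if $i_j-i_{j-1}\ge t$ for $2\le j\le d$. A $t$-spread monomial ideal is an ideal generated by $t$-spread monomials. A $t$-spread monomial ideal $I$ is $t$-spread strongly stable if for all $w\in G(I)$, $j\in\operatorname{supp}(w)$ and $i<j$ such that $x_i(w/x_j)$ is $t$-spread, one has $x_i(w/x_j)\in I$. For a $t$-spread monomial $u=x_{i_1}\cdots x_{i_d}$, $B_t(u)$ denotes the smallest $t$-spread strongly stable ideal containing $u$ (the $t$-spread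 principal Borel ideal of $u$). Explicitly, $G(B_t(u))$ consists of the monomials $x_{j_1}\cdots x_{j_d}$ with $j_k\le i_k$ for $1\le k\le d$ and $j_k-j_{k-1}\ge t$ for $2\le k\le d$. *)

(* Defs.v *)
From HB Require Import structures.
From mathcomp Require Import all_boot all_order all_algebra.
From mathcomp Require Import generic_quotient ring_quotient boolp mpoly.

Set Implicit Arguments.
Unset Strict Implicit.
Unset Printing Implicit Defensive.

Import GRing.Theory.
Local Open Scope ring_scope.
Local Open Scope quotient_scope.

Definition is_max (P : nat -> Prop) (e : nat) : Prop :=
  P e /\ forall l, P l -> (l <= e)%N.

Section QuotientModule.
Variables (R : nzRingType) (V : lmodType R) (U : submodClosed V).

(* Over a ring, a submodule is closed under opposites, which submodClosed    *)
(* does not record but the quotient construction requires.                   *)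
Definition submod_pred : {pred V} := U.

Fact submod_zmod_closed : zmod_closed submod_pred.
Proof.
have [U0 UZD] := GRing.submodClosedP U.
by split=> // v w Uv Uw; rewrite addrC -scaleN1r; apply: UZD.
Qed.

HB.instance Definition _ :=
  GRing.isZmodClosed.Build V submod_pred submod_zmod_closed.

Definition quotmod : Type := Quotient.quot submod_pred.
HB.instance Definition _ := GRing.Zmodule.on quotmod.

Definition quotmod_pi (v : V) : quotmod := \pi_(Quotient.quot submod_pred) v.

Lemma quotmod_pi_surj (x : quotmod) : exists v, x = quotmod_pi v.
Proof. by exists (repr x); rewrite /quotmod_pi reprK. Qed.

Lemma quotmod_piE (v w : V) : quotmod_pi v = quotmod_pi w <-> v - w \in U.
Proof.
by rewrite -[_ \in _]/(v - w \in submod_pred) Quotient.idealrBE; split=> /eqP.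
Qed.

Lemma quotmod_piD : {morph quotmod_pi : v w / v + w}.
Proof. by move=> v w; rewrite /quotmod_pi raddfD. Qed.

Definition quotmod_scale (a : R) (x : quotmod) : quotmod :=
  quotmod_pi (a *: repr (x : Quotient.quot submod_pred)).

Lemma quotmod_piZ a v : quotmod_scale a (quotmod_pi v) = quotmod_pi (a *: v).
Proof.
apply/quotmod_piE; rewrite -scalerBr; apply: (rpredZ (s := U)).
by apply/quotmod_piE; rewrite /quotmod_pi reprK.
Qed.

Fact quotmod_scaleA a b x :
  quotmod_scale a (quotmod_scale b x) = quotmod_scale (a * b) x.
Proof. by have [v ->] := quotmod_pi_surj x; rewrite !quotmod_piZ scalerA. Qed.

Fact quotmod_scale1 : left_id 1 quotmod_scale.
Proof.
by move=> x; have [v ->] := quotmod_pi_surj x; rewrite quotmod_piZ scale1r.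
Qed.

Fact quotmod_scaleDr : right_distributive quotmod_scale +%R.
Proof.
move=> a x y; have [v ->] := quotmod_pi_surj x.
have [w ->] := quotmod_pi_surj y.
by rewrite -quotmod_piD !quotmod_piZ -quotmod_piD scalerDr.
Qed.

Fact quotmod_scaleDl x : {morph quotmod_scale^~ x : a b / a + b}.
Proof.
move=> a b; have [v ->] := quotmod_pi_surj x.
by rewrite !quotmod_piZ -quotmod_piD scalerDl.
Qed.

HB.instance Definition _ := GRing.Zmodule_isLmodule.Build R quotmod
  quotmod_scaleA quotmod_scale1 quotmod_scaleDr quotmod_scaleDl.

End QuotientModule.

Section Ideals.
Variable R : comNzRingType.
Implicit Types (X I : {pred R}) (f g : R).

Definition ideal_gen X : {pred R^o} := fun f => `[<
  exists2 s : seq (R * R), all (fun p => p.2 \in X) s &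
    f = \sum_(p <- s) p.1 * p.2 >].

Lemma mem_ideal_gen X f : f \in X -> f \in ideal_gen X.
Proof.
move=> Xf; apply/asboolP; exists [:: (1, f)]; first by rewrite /= Xf.
by rewrite big_seq1 mul1r.
Qed.

Fact ideal_gen_submod_closed X :
  GRing.submod_closed (ideal_gen X : {pred R^o}).
Proof.
split=> [|a f g /asboolP[s sX ->] /asboolP[r rX ->]]; apply/asboolP.
  by exists [::]; rewrite ?big_nil.
exists ([seq (a * p.1, p.2) | p <- s] ++ r).
  by rewrite all_cat rX andbT all_map; apply: sub_all sX.
rewrite big_cat big_map /=; congr (_ + _); rewrite /GRing.scale /= mulr_sumr.
by apply: eq_bigr => p _; rewrite mulrA.
Qed.

HB.instance Definition _ X :=
  GRing.isSubmodClosed.Build R R^o (ideal_gen X) (ideal_gen_submod_closed X).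

Lemma ideal_gen_ind X (P : R -> Prop) :
    P 0 -> (forall f g, P f -> P g -> P (f + g)) ->
    (forall a f, f \in X -> P (a * f)) ->
  forall f, f \in ideal_gen X -> P f.
Proof.
move=> P0 PD PX f /asboolP[s sX ->].
elim: s sX => [|[a g] s IH] /=; first by rewrite big_nil.
by case/andP=> gX sX; rewrite big_cons; apply: PD; [apply: PX | apply: IH].
Qed.

Lemma ideal_gen0 X : 0 \in ideal_gen X.
Proof. by have [] := ideal_gen_submod_closed X. Qed.

Lemma ideal_genD X f g :
  f \in ideal_gen X -> g \in ideal_gen X -> f + g \in ideal_gen X.
Proof.
move=> hf hg; have [_ h] := ideal_gen_submod_closed X.
by have := h 1 f g hf hg; rewrite scale1r.
Qed.

Lemma ideal_genM X a f : f \in ideal_gen X -> a * f \in ideal_gen X.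
Proof.
move=> hf; have [_ h] := ideal_gen_submod_closed X.
by have := h a f 0 hf (ideal_gen0 X); rewrite addr0.
Qed.

(* For k = 0 this is the empty product 1, so that ideal_pow I 0 is R. *)
Definition kprods I (k : nat) : {pred R} := fun f => `[<
  exists2 s : k.-tuple R, all (mem I) s & f = \prod_(g <- s) g >].

Definition ideal_pow I (k : nat) : {pred R^o} := ideal_gen (kprods I k).

HB.instance Definition _ I k :=
  GRing.isSubmodClosed.Build R R^o (ideal_pow I k)
    (ideal_gen_submod_closed (kprods I k)).

Lemma ideal_powM I k l f g :
  f \in ideal_pow I k -> g \in ideal_pow I l -> f * g \in ideal_pow I (k + l).
Proof.
move=> hf hg; elim/ideal_gen_ind: hf => [|f1 f2 h1 h2|a f' hf].
- by rewrite mul0r ideal_gen0.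
- by rewrite mulrDl ideal_genD.
rewrite -mulrA; apply: ideal_genM.
elim/ideal_gen_ind: hg => [|f1 f2 h1 h2|b g' hg].
- by rewrite mulr0 ideal_gen0.
- by rewrite mulrDr ideal_genD.
rewrite mulrCA; apply: ideal_genM; apply: mem_ideal_gen.
case/asboolP: hf => s sI ->; case/asboolP: hg => r rI ->.
apply/asboolP; exists (cat_tuple s r); first by rewrite all_cat sI rI.
by rewrite big_cat.
Qed.

End Ideals.

Section Depth.
Variable R : comNzRingType.

Section MultipleSubmodule.
Variables (M : lmodType R) (f : R).

Definition mult_submod : {pred M} := fun v => `[< exists w, v = f *: w >].

Fact mult_submod_closed : GRing.submod_closed mult_submod.
Proof.
split=> [|a v w /asboolP[v' ->] /asboolP[w' ->]]; apply/asboolP.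
  by exists 0; rewrite scaler0.
by exists (a *: v' + w'); rewrite scalerDr !scalerA mulrC.
Qed.

HB.instance Definition _ :=
  GRing.isSubmodClosed.Build R M mult_submod mult_submod_closed.

End MultipleSubmodule.

Arguments mult_submod : clear implicits.

(* f_1, ..., f_r is M-regular: f_i is a nonzerodivisor on                    *)
(* M / (f_1, ..., f_(i-1)) M, and M / (f_1, ..., f_r) M is nonzero.          *)
Fixpoint regular_seq (M : lmodType R) (s : seq R) : Prop :=
  if s is f :: s' then
    (forall x : M, f *: x = 0 -> x = 0) /\
    regular_seq (quotmod (mult_submod M f)) s'
  else exists x : M, x != 0.

Definition has_depth (a : {pred R}) (M : lmodType R) (e : nat) : Prop :=
  is_max (fun l => exists s : seq R,
    [/\ size s = l, all (mem a) s & regular_seq M s]) e.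

End Depth.

Definition has_krull_dim (A : comNzRingType) (e : nat) : Prop :=
  is_max (fun l => exists P : 'I_l.+1 -> prime_idealr A,
    forall i j : 'I_l.+1, (i < j)%N ->
      {subset P i <= P j} /\ ~ {subset P j <= P i}) e.

Section Rees.
Variables (R : comNzRingType) (I : {pred R}).

(* The direct sum of the I^j y^j inside R[y]. *)
Definition rees_pred : {pred {poly R}} := fun p => `[<
  forall j, p`_j \in ideal_pow I j >].

Fact rees_subring_closed : subring_closed rees_pred.
Proof.
split=> [|p q /asboolP hp /asboolP hq|p q /asboolP hp /asboolP hq];
  apply/asboolP => j.
- rewrite coef1; case: eqP => [->|_]; last exact: ideal_gen0.
  apply: mem_ideal_gen; apply/asboolP.
  by exists [tuple]; rewrite ?big_nil.
- rewrite coefB -mulN1r; apply: ideal_genD; first exact: hp.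
  exact: ideal_genM.
- rewrite coefM; elim/big_ind: _ => [||i _].
  + exact: ideal_gen0.
  + exact: ideal_genD.
  have ij : (i <= j)%N := ltn_ord i.
  by have := ideal_powM (hp i) (hq (j - i)%N); rewrite subnKC.
Qed.

HB.instance Definition _ :=
  GRing.isSubringClosed.Build {poly R} rees_pred rees_subring_closed.

Record rees := Rees { rees_val :> {poly R}; _ : rees_val \in rees_pred }.
HB.instance Definition _ := [isSub for rees_val].
HB.instance Definition _ := [Choice of rees by <:].
HB.instance Definition _ := [SubChoice_isSubComNzRing of rees by <:].

Variable m : idealr R.

(* The extension m R(I), the elements of R being those of degree 0. *)
Definition rees_ext : {pred rees} :=
  ideal_gen (fun p : rees => `[< exists2 a, a \in m & val p = a%:P >]).

Fact rees_ext_idealr_closed : idealr_closed rees_ext.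
Proof.
split; first exact: ideal_gen0.
  suff h (p : rees) : p \in rees_ext -> (val p)`_0 \in m.
    apply/negP => /h; rewrite rmorph1 coef1 eqxx.
    by rewrite idealr1.
  elim/ideal_gen_ind => [|p1 p2 h1 h2|a q /asboolP[b mb qE]].
  - by rewrite rmorph0 coef0 rpred0.
  - by rewrite rmorphD coefD rpredD.
  by rewrite rmorphM /= [rees_val q]qE coefMC idealMr.
move=> a p q hp hq; apply: ideal_genD => //; exact: ideal_genM.
Qed.

HB.instance Definition _ :=
  isIdealr.Build rees rees_ext rees_ext_idealr_closed.

Definition fiber_ring : Type := {ideal_quot rees_ext}.
HB.instance Definition _ := GRing.ComNzRing.on fiber_ring.

End Rees.

(* 'X_j with j : 'I_n stands for x_(j+1). *)

Section MonomialIdeals.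
Variables (K : fieldType) (n : nat).
Local Notation S := {mpoly K[n]}.
Implicit Types (I J : {pred S}) (G : {pred 'X_{1..n}}) (w : 'X_{1..n}).

Definition max_ideal : {pred S} :=
  ideal_gen (fun f : S => `[< exists j : 'I_n, f = 'X_j >]).

Fact max_ideal_idealr_closed : idealr_closed max_ideal.
Proof.
split; first exact: ideal_gen0.
  suff h (f : S) : f \in max_ideal -> f.@[fun=> 0] = 0.
    by apply/negP => /h /eqP; rewrite meval1 oner_eq0.
  elim/ideal_gen_ind => [|f1 f2 h1 h2|a g /asboolP[j ->]].
  - exact: meval0.
  - by rewrite mevalD h1 h2 addr0.
  by rewrite mevalM mevalXU mulr0.
move=> a f g hf hg; apply: ideal_genD => //; exact: ideal_genM.
Qed.

HB.instance Definition _ :=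
  isIdealr.Build S max_ideal max_ideal_idealr_closed.

Definition has_analytic_spread I (e : nat) : Prop :=
  has_krull_dim (fiber_ring I max_ideal) e.

Definition mon_ideal G : {pred S} :=
  ideal_gen (fun f : S => `[< exists2 w, w \in G & f = 'X_[w] >]).

Definition is_min_mon_gens I G : Prop :=
  I =i mon_ideal G /\
  forall G', {subset G' <= G} -> I =i mon_ideal G' -> G' =i G.

Variable t : nat.

Definition tspread w : Prop :=
  exists2 s : seq 'I_n, sorted (fun a b : 'I_n => (a <= b) && (t <= b - a))%N s &
    w = (\sum_(j <- s) U_(j))%MM.

Definition tspread_ideal I : Prop :=
  exists2 G, (forall w, w \in G -> tspread w) & I =i mon_ideal G.

Definition tspread_strongly_stable I : Prop :=
  tspread_ideal I /\
  forall G w (i j : 'I_n), is_min_mon_gens I G -> w \in G ->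
    (0 < w j)%N -> (i < j)%N ->
    tspread (w - U_(j) + U_(i))%MM -> 'X_[(w - U_(j) + U_(i))%MM] \in I.

(* I is the least t-spread strongly stable ideal containing u, i.e. B_t(u). *)
Definition is_tspread_principal_borel (u : 'X_{1..n}) I : Prop :=
  [/\ tspread_strongly_stable I, 'X_[u] \in I &
      forall J, tspread_strongly_stable J -> 'X_[u] \in J -> {subset I <= J}].

End MonomialIdeals.

Arguments max_ideal : clear implicits.

(* Main.v *)
Require Import Defs.
From HB Require Import structures.
From mathcomp Require Import all_boot all_order all_algebra.
From mathcomp Require Import generic_quotient ring_quotient boolp mpoly.
From mathcomp Require Import zify.

(* Depth. Let v_k(c) be the generator x_1 x_(t+1) ... x_((k-2)t+1) x_c x_(i_(k+1))
   ... x_(i_d), with c in position k, and b_k = v_k(c) / x_c. The monomial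
   w = b_1 ... b_d x_(i_1) ... x_(i_(d-1)) has degree d^2 - 1, and for every j the
   numbers j, i_1, ..., i_(d-1), once sorted, can be put into the d free slots, so
   that x_j w is a product of d generators. Hence w u^(k-d) is a socle element of
   S/I^k: its degree dk - 1 is too small for I^k.

   Analytic spread. I is generated in degree d, so the fiber ring is the subalgebra
   of S spanned by the monomials x^a of degree d j lying in I^j.
   - A chain of primes P_0 < ... < P_(n+1) and a_k in P_(k+1) \ P_k would make
     a_0, ..., a_n algebraically independent over K, whereas n + 1 elements of S are
     algebraically dependent.
   - A strict chain of n + 1 primes is given by the faces of the semigroup of the
     fiber ring: adding one at a time, for c = n - 1, ..., 1, the condition that
     x_c does not occur or, if c = i_a, that x_(i_(a+1)) occurs with the maximal
     exponent j; the last face is {0}. The generators v_k(c) show that each face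
     is strictly smaller than the one before. *)

Set Implicit Arguments.
Unset Strict Implicit.
Unset Printing Implicit Defensive.

Import GRing.Theory.
Local Open Scope ring_scope.

(** * Krull dimension and algebraic dependence *)

Section AlgebraicDependence.
Variables (K : fieldType) (n : nat).
Implicit Types p q : {mpoly K[n]}.

Lemma msizeM_leS p q a b :
  (msize p <= a.+1 -> msize q <= b.+1 -> msize (p * q) <= (a + b).+1)%N.
Proof.
move=> hp hq; rewrite msizeE; apply/bigmax_leqP_seq => m.
move=> /msuppM_le/allpairsP[[m1 m2] /= [m1p m2q ->]] _.
rewrite mdegD; have := msize_mdeg_lt m1p; have := msize_mdeg_lt m2q; lia.
Qed.

Lemma msizeX_leS p a e :
  (msize p <= a.+1 -> msize (p ^+ e) <= (e * a).+1)%N.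
Proof.
move=> hp; elim: e => [|e IH]; first by rewrite expr0 msize1.
by rewrite exprS mulSn; apply: msizeM_leS.
Qed.

Lemma msize_prod_leS r (F : 'I_r -> {mpoly K[n]}) a :
  (forall i, msize (F i) <= a.+1)%N -> (msize (\prod_i F i) <= (r * a).+1)%N.
Proof.
elim: r F => [|r IH] F hF; first by rewrite big_ord0 msize1.
by rewrite big_ord_recl mulSn; apply: msizeM_leS => //; apply: IH.
Qed.

(* The N^(n+1) monomials in b with exponents < N lie in a space of polynomials
   of degree < N C, which has dimension at most (N C)^n < N^(n+1). *)
Lemma algebraic_dependence (b : 'I_n.+1 -> {mpoly K[n]}) :
  exists N (c : {ffun 'I_n.+1 -> 'I_N} -> K),
    (exists nu, c nu != 0) /\
    \sum_nu c nu *: \prod_i b i ^+ nu i = 0.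
Proof.
pose D := \max_i msize (b i).
(* [N] exceeds [C ^ n], which gives [M ^ n < N ^ n.+1]. *)
pose C := (n.+1 * D).+1; pose N := (C ^ n).+1; pose M := (N * C)%N.
exists N.
pose mon (f : {ffun 'I_n -> 'I_M}) : 'X_{1..n} := [multinom (f j : nat) | j < n].
pose T := {ffun 'I_n.+1 -> 'I_N}; pose U := {ffun 'I_n -> 'I_M}.
pose B (nu : T) := \prod_i b i ^+ nu i.
(* Row [x] lists the coefficients of one product of the [b i] at the monomials whose exponents are
   all below [M]. There are more rows than columns, so a nonzero vector in the left kernel supplies
   the coefficients [c]. *)
pose A : 'M[K]_(#|T|, #|U|) := \matrix_(x, y) (B (enum_val x))@_(mon (enum_val y)).
have ltUT : (#|U| < #|T|)%N.
  rewrite !card_ffun !card_ord expnMn expnS mulnC ltn_pmul2r ?expn_gt0 //.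
have : kermx A != 0.
  rewrite kermx_eq0; apply/negP => /eqP rA.
  by have := rank_leq_col A; rewrite rA leqNgt ltUT.
rewrite -nz_row_eq0; set v := nz_row _ => nzv.
have vA : v *m A = 0 by apply/sub_kermxP; apply: nz_row_sub.
exists (fun nu => v 0 (enum_rank nu)); split.
  apply: contrapT => h; case/eqP: nzv; apply/rowP => x; rewrite mxE.
  by apply: contrapT => /eqP hx; apply: h; exists (enum_val x); rewrite enum_valK.
have sizeB nu : (msize (B nu) <= M)%N.
  have : (msize (B nu) <= (n.+1 * (N.-1 * D)).+1)%N.
    apply: msize_prod_leS => i.
    have hb : (msize (b i) <= D.+1)%N by apply: leqW; apply: leq_bigmax.
    apply: leq_trans (msizeX_leS (nu i) hb) _.
    by rewrite ltnS leq_mul2r; have := ltn_ord (nu i); lia.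
  move/leq_trans; apply; rewrite /M /C /N /=; nia.
apply/mpolyP => m; rewrite mcoeff0 raddf_sum /=.
(* No product has a term of degree at least [M]; every other monomial indexes a column of [A]. *)
case: (ltnP (mdeg m) M) => [hm|hm]; last first.
  rewrite big1 // => nu _; rewrite mcoeffZ memN_msupp_eq0 ?mulr0 //.
  by apply: msize_mdeg_ge; apply: leq_trans (sizeB nu) hm.
have hmj j : (m j < M)%N.
  by apply: leq_ltn_trans hm; rewrite mdegE (bigD1 j) //= leq_addr.
pose f : U := [ffun j => Ordinal (hmj j)].
have mf : mon f = m by apply/mnmP => j; rewrite mnmE ffunE.
have h := congr1 (fun w : 'rV_ _ => w 0 (enum_rank f)) vA.
rewrite !mxE in h; rewrite -[RHS]h.
rewrite [LHS](reindex (@enum_val T T)) /=; last first.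
  by exists enum_rank => x _; rewrite (enum_rankK, enum_valK).
by apply: eq_bigr => x _; rewrite mcoeffZ [in RHS]mxE enum_valK enum_rankK mf.
Qed.

End AlgebraicDependence.

Section KrullDependence.
Variables (K : fieldType) (A : comNzRingType) (kappa : {rmorphism K -> A}).

(* Take nu_0 minimal with a nonzero coefficient, then nu_1 minimal among those,
   and so on: dividing the relation by a_k^(nu_k), which is invertible modulo
   P_k, and reducing modulo P_(k+1), which contains a_k, leaves a nonzero
   constant in P_r. *)
Lemma krull_independence r N (P : nat -> prime_idealr A) (a : 'I_r -> A)
    (c : {ffun 'I_r -> 'I_N} -> K) :
    (forall k : 'I_r, a k \in P k.+1 /\ a k \notin P k) ->
    (forall k, (k < r)%N -> {subset P k <= P k.+1}) ->
    \sum_nu kappa (c nu) * \prod_i a i ^+ nu i = 0 ->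
  forall nu, c nu = 0.
Proof.
move=> ha sP rel nu0; apply: contrapT => /eqP c0.
pose agree k (nu mu : {ffun 'I_r -> 'I_N}) :=
  [forall i : 'I_r, (i < k)%N ==> (nu i == mu i)].
pose rest k (nu : {ffun 'I_r -> 'I_N}) :=
  \prod_(i < r | (k <= i)%N) a i ^+ nu i.
(* Invariant: among the terms whose first [k] exponents agree with [mu], the relation still holds
   modulo [P k] after the factors [a 0], ..., [a k.-1] are removed. *)
have main k : (k <= r)%N -> exists2 mu, c mu != 0 &
    \sum_(nu | agree k nu mu) kappa (c nu) * rest k nu \in P k.
  elim: k => [_|k IH kr].
    exists nu0 => //; rewrite (eq_bigl predT) ?rel ?rpred0 // => nu.
    by apply/forallP.
  have [mu1 c1 h1] := IH (ltnW kr).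
  pose i0 := Ordinal kr.
  pose C nu := agree k nu mu1 && (c nu != 0).
  have C1 : C mu1 by rewrite /C c1 andbT; apply/forallP => i; rewrite eqxx implybT.
  case: (arg_minnP (fun nu : {ffun 'I_r -> 'I_N} => nu i0 : nat) C1).
  move=> mu /andP[/forallP amu cmu] min_mu; exists mu => //.
  have agmu nu : agree k nu mu = agree k nu mu1.
    apply: eq_forallb => i; case: (ltnP i k) => //= ik.
    by have /= := amu i; rewrite ik /= => /eqP ->.
  have agS nu : agree k.+1 nu mu = agree k nu mu && (nu i0 == mu i0).
    apply/forallP/andP => [h|[/forallP h1' /eqP h2] i].
      split; last by have := h i0; rewrite /= ltnSn.
      by apply/forallP => i; apply/implyP => ik; have /implyP := h i; apply; lia.
    apply/implyP; rewrite ltnS leq_eqVlt => /orP[/eqP ik|]; last by apply/implyP/h1'.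
    by have -> : i = i0 by [apply: val_inj]; rewrite h2.
  have restS nu : rest k nu = a i0 ^+ nu i0 * rest k.+1 nu.
    rewrite /rest (bigD1 i0) //=; congr (_ * _); apply: eq_bigl => i.
    by rewrite -(inj_eq val_inj) /= andbC ltn_neqAle eq_sym.
  have [aS aN] := ha i0.
  have : a i0 ^+ mu i0 * \sum_(nu | agree k nu mu)
      kappa (c nu) * (a i0 ^+ (nu i0 - mu i0) * rest k.+1 nu) \in P k.
    rewrite (_ : _ * _ = \sum_(nu | agree k nu mu1) kappa (c nu) * rest k nu) //.
    rewrite mulr_sumr (eq_bigl _ _ agmu); apply: eq_bigr => nu agnu.
    have [->|cnu] := eqVneq (c nu) 0; first by rewrite rmorph0 !mul0r mulr0.
    rewrite mulrCA restS; congr (_ * _); rewrite mulrA -exprD subnKC //.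
    by apply: min_mu; rewrite /C agnu.
  (* [P k] is prime and omits [a i0], so the power of [a i0] can be cancelled. *)
  rewrite prime_idealrM => /orP[|h].
    elim: (mu i0 : nat) => [|e IHe]; first by rewrite expr0 idealr1.
    by rewrite exprS prime_idealrM (negPf aN).
  (* In [P k.+1] the terms with [nu i0 > mu i0] vanish, since they keep a factor [a i0]. *)
  have := sP _ kr _ h; rewrite (bigID (fun nu : {ffun 'I_r -> 'I_N} => nu i0 == mu i0)) /=.
  rewrite rpredDr; last first.
    apply: rpred_sum => nu /andP[agnu ne]; have [->|cnu] := eqVneq (c nu) 0.
      by rewrite rmorph0 mul0r rpred0.
    have : (mu i0 <= nu i0)%N by apply: min_mu; rewrite /C -agmu agnu.
    rewrite leq_eqVlt eq_sym (inj_eq val_inj) (negPf ne) /= -subn_gt0.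
    case: (nu i0 - mu i0)%N => // e _; rewrite exprS mulrCA -mulrA.
    by rewrite mulrC idealMr.
  rewrite (_ : \sum_(nu | _ && (_ == _)) _ = \sum_(nu | agree k.+1 nu mu)
    kappa (c nu) * rest k.+1 nu) // (eq_bigl _ _ agS).
  apply: eq_bigr => nu /andP[_ /eqP ->].
  by rewrite subnn expr0 mul1r.
have [mu cmu] := main r (leqnn r).
(* For [k = r] only the term of [mu] is left: the unit [kappa (c mu)] would lie in [P r]. *)
rewrite (big_pred1 mu) => [|nu]; last first.
  apply/forallP/eqP => [h|-> i]; last by rewrite eqxx implybT.
  by apply/ffunP => i; apply/eqP; have := h i; rewrite ltn_ord.
rewrite /rest big_pred0 ?mulr1 => [|i]; last by rewrite leqNgt ltn_ord.
move=> /(idealMr (kappa (c mu)^-1)).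
by rewrite -rmorphM mulVf // rmorph1 idealr1.
Qed.

End KrullDependence.

(** * Monomial ideals and principal Borel ideals *)

Section MonomialIdealTheory.
Variables (K : fieldType) (n : nat).
Local Notation S := {mpoly K[n]}.
Local Notation monI := (@mon_ideal K n).
Implicit Types (I : {pred S}) (G B : {pred 'X_{1..n}}) (v w : 'X_{1..n}).

Lemma lepm_anti v w : (v <= w)%MM -> (w <= v)%MM -> v = w.
Proof.
move=> /mnm_lepP h1 /mnm_lepP h2; apply/mnmP => c.
by apply/eqP; rewrite eqn_leq h1 h2.
Qed.

Lemma mdeg_lem v w : (v <= w)%MM -> (mdeg v <= mdeg w)%N.
Proof. by move=> /submK <-; rewrite mdegD leq_addl. Qed.

Lemma lepm_mdeg_eq v w : (v <= w)%MM -> (mdeg w <= mdeg v)%N -> v = w.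
Proof.
move=> vw; rewrite -{1}(submK vw) mdegD -[leqRHS]add0n leq_add2r leqn0 mdeg_eq0.
by move=> /eqP w0; rewrite -(submK vw) w0 add0m.
Qed.

Lemma mon_idealX G v w : v \in G -> (v <= w)%MM -> 'X_[w] \in monI G.
Proof.
move=> Gv vw; rewrite -(submK vw) mpolyXD; apply: ideal_genM.
by apply: mem_ideal_gen; apply/asboolP; exists v.
Qed.

Lemma mon_ideal_supp G f w :
  f \in monI G -> w \in msupp f -> exists2 v, v \in G & (v <= w)%MM.
Proof.
move=> fG; move: w; elim/ideal_gen_ind: fG => [w|f1 f2 h1 h2 w|a g].
- by rewrite msupp0.
- by move/msuppD_le; rewrite mem_cat => /orP[/h1|/h2].
move=> /asboolP[v Gv ->] w; rewrite (perm_mem (msuppMX _ _)) => /mapP[w' _ ->].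
by exists v => //; apply: lem_addr.
Qed.

Lemma mon_idealXP G w :
  'X_[w] \in monI G <-> exists2 v, v \in G & (v <= w)%MM.
Proof.
split=> [h|[v Gv vw]]; last exact: mon_idealX vw.
by apply: mon_ideal_supp h _; rewrite msuppX mem_seq1.
Qed.

Lemma mon_ideal_sub G B :
  (forall v, v \in G -> 'X_[v] \in monI B) ->
  {subset monI G <= monI B}.
Proof.
move=> h f; elim/ideal_gen_ind => [|f1 f2|a g /asboolP[v Gv ->]].
- exact: ideal_gen0.
- exact: ideal_genD.
- by apply: ideal_genM; apply: h.
Qed.

Lemma min_mon_gens_sub I G B :
  I =i monI B -> is_min_mon_gens I G -> {subset G <= B}.
Proof.
move=> IB [IG minG] w Gw.
have /mon_idealXP[b Bb bw] : 'X_[w] \in monI B.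
  by rewrite -IB IG; apply: mon_idealX Gw (lepm_refl w).
have /mon_idealXP[g Gg gb] : 'X_[b] \in monI G.
  by rewrite -IG IB; apply: mon_idealX Bb (lepm_refl b).
have gw := lepm_trans gb bw.
have [gwE|gNw] := eqVneq g w.
  by rewrite -gwE in bw *; rewrite (lepm_anti gb bw).
pose G' : {pred 'X_{1..n}} := [pred v in G | v != w].
have : w \in G' -> False by rewrite inE eqxx andbF.
case; rewrite (minG G') // => [v|f]; first by rewrite inE => /andP[].
rewrite IG; apply/idP/idP; apply: mon_ideal_sub => v.
  move=> Gv; have [->|vw] := eqVneq v w.
    by apply: mon_idealX gw; rewrite inE Gg.
  by apply: mon_idealX (lepm_refl v); rewrite inE Gv.
by rewrite inE => /andP[Gv _]; apply: mon_idealX Gv (lepm_refl v).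
Qed.

(** Induction on the degree puts a divisibility-minimal monomial of [I] below each monomial of [I].
    Strong stability speaks of minimal generating sets, so one has to be exhibited before it can be
    applied. *)
Lemma exists_min_mon_gens I B : I =i monI B ->
  is_min_mon_gens I (fun w => `[< 'X_[w] \in I /\
     forall v, 'X_[v] \in I -> (v <= w)%MM -> v = w >]).
Proof.
move=> IB; set G : {pred _} := fun w => _.
have below w : 'X_[w] \in I -> exists2 v, v \in G & (v <= w)%MM.
  elim: {w}(mdeg w) {-2}w (leqnn (mdeg w)) => [|e IH] w hw Iw.
    exists w; last exact: lepm_refl.
    apply/asboolP; split=> // v _ vw; apply: lepm_mdeg_eq => //; lia.
  have [Gw|/asboolPn NGw] := boolP (w \in G); first by exists w; rewrite ?lepm_refl.
  have [v [Iv vw vNw]] : exists v, [/\ 'X_[v] \in I, (v <= w)%MM & v <> w].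
    apply: contrapT => h; apply: NGw; split=> // v Iv vw.
    by apply: contrapT => vNw; apply: h; exists v.
  have dv : (mdeg v <= e)%N.
    rewrite -ltnS; apply: leq_trans hw; rewrite ltnNge; apply/negP.
    by move/(lepm_mdeg_eq vw).
  by have [v' Gv' v'v] := IH v dv Iv; exists v' => //; apply: lepm_trans vw.
have IG : I =i monI G.
  move=> f; rewrite IB; apply/idP/idP; apply: mon_ideal_sub => v.
    move=> Bv; have /below[v' Gv' v'v] : 'X_[v] \in I.
      by rewrite IB; apply: mon_idealX Bv (lepm_refl v).
    exact: mon_idealX v'v.
  by move=> /asboolP[Iv _]; rewrite -IB.
split=> // G' sG' IG' w; apply/idP/idP; first exact: sG'.
move=> Gw; have /asboolP[Iw minw] := Gw.
have /mon_idealXP[v G'v vw] : 'X_[w] \in monI G' by rewrite -IG'.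
by have /asboolP[Iv _] := sG' _ G'v; rewrite -(minw v).
Qed.

Variables (t : nat).

Lemma mnm_sum1E (s : seq 'I_n) c : (\sum_(x <- s) U_(x))%MM c = count_mem c s.
Proof.
rewrite mnm_sumE; under eq_bigr do rewrite mnm1E.
by rewrite -sum1_count [RHS]big_mkcond; apply: eq_bigr => x _ /=; case: (x == c).
Qed.

Lemma mnm_sum_mkseq (f : nat -> 'I_n) m :
  (\sum_(x <- mkseq f m) U_(x))%MM = (\sum_(a < m) U_(f a))%MM.
Proof.
rewrite big_map -(big_mkord xpredT (fun a => U_(f a)%MM)).
by rewrite /index_iota subn0.
Qed.

Lemma tspread_sorted_lt (s : seq 'I_n) : (1 <= t)%N ->
  sorted (fun a b : 'I_n => (a <= b) && (t <= b - a))%N s ->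
  sorted (fun a b : 'I_n => (a < b)%N) s.
Proof. by move=> t0; apply: sub_sorted => a b /=; lia. Qed.

Lemma ltn_ord_trans : transitive (fun a b : 'I_n => (a < b)%N).
Proof. by move=> a b c /= /ltn_trans; apply. Qed.

Lemma tspread_le1 w : (1 <= t)%N -> tspread t w -> forall c, (w c <= 1)%N.
Proof.
move=> t0 [s /(tspread_sorted_lt t0) hs ->] c.
have us : uniq s.
  by apply: sorted_uniq hs; [apply: ltn_ord_trans | move=> a; apply: ltnn].
by rewrite mnm_sum1E count_uniq_mem //; apply: leq_b1.
Qed.

Lemma mdeg_exchange w (i j : 'I_n) :
  (0 < w j)%N -> mdeg (w - U_(j) + U_(i))%MM = mdeg w.
Proof.
move=> wj; have jw : (U_(j) <= w)%MM by rewrite lep1mP -lt0n.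
by rewrite mdegD mdeg1 -[in RHS](submK jw) mdegD mdeg1.
Qed.

(** * Generators of a principal Borel ideal *)

Section PrincipalBorel.
Variables (u : 'X_{1..n}) (I : {pred S}).
Hypotheses (tu : tspread t u) (borelI : is_tspread_principal_borel t u I).

Definition borel_gens : {pred 'X_{1..n}} :=
  fun w => `[< [/\ tspread t w, mdeg w = mdeg u & 'X_[w] \in I] >].

(** All [t]-spread monomials of degree [mdeg u] generate a strongly stable ideal containing [u],
    which contains [I] because [I] is the least one. *)
Lemma borel_mdeg_ge w : 'X_[w] \in I -> (mdeg u <= mdeg w)%N.
Proof.
pose B : {pred 'X_{1..n}} := fun w => `[< tspread t w /\ mdeg w = mdeg u >].
have [_ _ minI] := borelI; move=> /(minI (monI B)).
have uB : 'X_[u] \in monI B.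
  by apply: mon_idealX (lepm_refl u); apply/asboolP.
have stB : tspread_strongly_stable t (monI B).
  split; first by exists B => // v /asboolP[].
  move=> G v i j mG Gv vj ij tv.
  have /asboolP[_ dv] := min_mon_gens_sub (frefl _) mG Gv.
  apply: mon_idealX (lepm_refl _); apply/asboolP; split=> //.
  by rewrite mdeg_exchange.
move=> /(_ stB uB)/mon_idealXP[v /asboolP[_ <-]]; exact: mdeg_lem.
Qed.

(** A monomial of [I] of the least possible degree [mdeg u] is a minimal generator, so the stability
    of [I] applies to it. *)
Lemma borel_gens_exchange w (i j : 'I_n) :
    w \in borel_gens -> (0 < w j)%N -> (i < j)%N ->
    tspread t (w - U_(j) + U_(i))%MM ->
  (w - U_(j) + U_(i))%MM \in borel_gens.
Proof.
move=> /asboolP[tw dw Iw] wj ij tw'; apply/asboolP; split=> //.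
  by rewrite mdeg_exchange.
have [[[B _ IB] stI] _ _] := borelI.
apply: stI (exists_min_mon_gens IB) _ wj ij tw'.
apply/asboolP; split=> // v Iv vw; apply: lepm_mdeg_eq => //.
by rewrite dw; apply: borel_mdeg_ge.
Qed.

(** By the exchange property [borel_gens] generates a strongly stable ideal containing [u]; the
    minimality of [I] gives the inclusion that is not immediate. *)
Lemma borel_gensE : I =i monI borel_gens.
Proof.
have [[[B _ IB] _] Iu minI] := borelI.
move=> f; apply/idP/idP; last first.
  rewrite IB; apply: mon_ideal_sub => v /asboolP[_ _].
  by rewrite IB.
apply: minI; last first.
  by apply: mon_idealX (lepm_refl u); apply/asboolP.
split; first by exists borel_gens => // v /asboolP[].
move=> G w i j mG Gw wj ij tw; apply: mon_idealX (lepm_refl _).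
by apply: borel_gens_exchange => //; apply: min_mon_gens_sub mG _ Gw.
Qed.

End PrincipalBorel.
End MonomialIdealTheory.

(** * Socle elements and kernels of maps from a quotient *)

Section DepthZero.
Variables (R : comNzRingType) (X : {pred R}) (U : submodClosed R^o).

(** The class of [w] is a nonzero socle element: it is killed by the whole ideal, so no element of
    the ideal can start a regular sequence. *)
Lemma has_depth0 (w : R) :
  w \notin (U : {pred R}) -> (forall x, x \in X -> x * w \in (U : {pred R})) ->
  has_depth (ideal_gen X) (quotmod U) 0.
Proof.
move=> Uw XwU.
have pi0 : quotmod_pi U 0 = 0 by rewrite /quotmod_pi raddf0.
have nzw : quotmod_pi U w != 0.
  apply: contra Uw => /eqP w0.
  have /quotmod_piE : quotmod_pi U w = quotmod_pi U 0.
    by rewrite w0 pi0.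
  by rewrite subr0.
split=> [|l [[|f s] [<- //]]].
  by exists [::]; split=> //; exists (quotmod_pi U w).
case=> /andP[Xf _] [reg _]; have {}Xf : f \in ideal_gen X := Xf.
case/eqP: nzw; apply: reg.
rewrite [LHS]quotmod_piZ -pi0.
apply/quotmod_piE; rewrite subr0; elim/ideal_gen_ind: Xf => [|x y hx hy|a x Xx].
- by rewrite scale0r rpred0.
- by rewrite scalerDl rpredD.
- by rewrite -scalerA rpredZ //; apply: XwU.
Qed.

End DepthZero.

Section QuotientKernel.
Local Open Scope quotient_scope.
Variables (A : comNzRingType) (J : idealr A) (D : idomainType).
Variables (phi : {rmorphism A -> D}) (phiJ : forall x, x \in J -> phi x = 0).

(** The kernel of the map that [phi] induces on the quotient. The vanishing proof is an argument so
    that the prime ideal structure can be attached to the term. *)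
Definition quot_ker of (forall x, x \in J -> phi x = 0) :
  {pred {ideal_quot J}} := fun x => phi (repr x) == 0.

Lemma quot_kerE x : (\pi_{ideal_quot J} x \in quot_ker phiJ) = (phi x == 0).
Proof.
rewrite unfold_in; suff -> : phi (repr (\pi_{ideal_quot J} x)) = phi x by [].
apply/eqP; rewrite -subr_eq0 -rmorphB phiJ //.
by rewrite Quotient.idealrBE reprK.
Qed.

Fact quot_ker_idealr_closed : idealr_closed (quot_ker phiJ).
Proof.
split=> [||a x y].
- by rewrite -(rmorph0 (\pi_{ideal_quot J})) quot_kerE rmorph0.
- by rewrite -(rmorph1 (\pi_{ideal_quot J})) quot_kerE rmorph1 oner_eq0.
rewrite -[a]reprK -[x]reprK -[y]reprK -rmorphM -rmorphD !quot_kerE.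
by move=> /eqP hx /eqP hy; rewrite rmorphD rmorphM hx hy mulr0 addr0.
Qed.

HB.instance Definition _ :=
  isIdealr.Build {ideal_quot J} (quot_ker phiJ) quot_ker_idealr_closed.

Fact quot_ker_prime : prime_idealr_closed (quot_ker phiJ).
Proof.
move=> x y; rewrite -[x]reprK -[y]reprK -rmorphM !quot_kerE.
by rewrite rmorphM mulf_eq0.
Qed.

HB.instance Definition _ :=
  isPrimeIdealrClosed.Build {ideal_quot J} (quot_ker phiJ) quot_ker_prime.

End QuotientKernel.

(** * Initial forms along the faces of the Rees semigroup *)

Lemma coef_rees_const (R : comNzRingType) (I : {pred R}) (p : rees I) (c : R) j :
  val p = c%:P -> (val p)`_j = if j == 0%N then c else 0.
Proof. by move=> ->; rewrite coefC. Qed.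

Section Truncation.
Variables (K : fieldType) (n : nat).
Implicit Types (f g : {mpoly K[n]}) (P : pred 'X_{1..n}).

Definition mtrunc P f : {mpoly K[n]} :=
  \sum_(w <- msupp f | P w) f@_w *: 'X_[w].

Lemma mcoeff_trunc P f w : (mtrunc P f)@_w = if P w then f@_w else 0.
Proof.
rewrite /mtrunc raddf_sum /=; under eq_bigr do rewrite mcoeffZ mcoeffX.
have [wf|wf] := boolP (w \in msupp f); last first.
  rewrite (memN_msupp_eq0 wf) if_same big_seq_cond big1 // => v /andP[vf _].
  by case: eqP wf vf => [-> /negPf ->|_ _ _]; rewrite ?mulr0.
rewrite big_mkcond (bigD1_seq w) ?msupp_uniq //= eqxx mulr1 big1 ?addr0 // => v.
by move=> /negPf ->; rewrite mulr0 if_same.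
Qed.

Fact mtrunc_is_zmod_morphism P : zmod_morphism (mtrunc P).
Proof.
move=> f g; apply/mpolyP => w; rewrite mcoeffB !mcoeff_trunc mcoeffB.
by case: ifP; rewrite ?subr0.
Qed.

HB.instance Definition _ P := GRing.isZmodMorphism.Build
  {mpoly K[n]} {mpoly K[n]} (mtrunc P) (mtrunc_is_zmod_morphism P).

(** Splitting is asked only on the supports, because a face splits sums only inside the Rees
    semigroup. *)
Lemma mtruncM P P1 P2 f g :
    {in msupp f & msupp g, forall v w, P (v + w)%MM = P1 v && P2 w} ->
  mtrunc P (f * g) = mtrunc P1 f * mtrunc P2 g.
Proof.
move=> hP; apply/mpolyP => m; rewrite mcoeff_trunc !mcoeffM.
rewrite [RHS](eq_bigr (fun k : 'X_{1..n < _, _} =>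
  if P m then f@_k.1 * g@_k.2 else 0)) => [|k /eqP mk].
  by case: (P m) => //; rewrite big1.
rewrite !mcoeff_trunc.
have [kf|/memN_msupp_eq0 ->] := boolP (val k.1 \in msupp f); last first.
  by rewrite !if_same !mul0r if_same.
have [kg|/memN_msupp_eq0 ->] := boolP (val k.2 \in msupp g); last first.
  by rewrite !if_same !mulr0 if_same.
have -> : P m = P1 k.1 && P2 k.2 by rewrite [in LHS]mk hP.
by case: (P1 _); case: (P2 _); rewrite /= ?mulr0 ?mul0r.
Qed.

End Truncation.

Section MonomialWeight.
Variable n : nat.
Implicit Types (omega : 'I_n -> nat) (v w : 'X_{1..n}).

Definition mwt omega w : nat := \sum_c omega c * w c.

Lemma mwtD omega v w : mwt omega (v + w)%MM = (mwt omega v + mwt omega w)%N.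
Proof.
by rewrite /mwt -big_split; apply: eq_bigr => c _; rewrite mnmDE mulnDr.
Qed.

Lemma mwt0 omega : mwt omega 0%MM = 0%N.
Proof. by rewrite /mwt big1 // => c _; rewrite mnm0E muln0. Qed.

Lemma mwt_const w : mwt (fun=> 1%N) w = mdeg w.
Proof. by rewrite mdegE; apply: eq_bigr => c _; rewrite mul1n. Qed.

Lemma mwt_pred1 (c : 'I_n) w : mwt (pred1 c : pred _) w = w c.
Proof.
rewrite /mwt (bigD1 c) //= eqxx mul1n big1 ?addn0 // => e /negPf ec.
by rewrite ec mul0n.
Qed.

Lemma mwt_predC1 (c : 'I_n) w : (mwt (predC1 c : pred _) w + w c = mdeg w)%N.
Proof.
rewrite mdegE [RHS](bigD1 c) //= addnC /mwt (bigD1 c) //= eqxx mul0n add0n.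
by congr (_ + _)%N; apply: eq_bigr => e ->; rewrite mul1n.
Qed.

End MonomialWeight.

(** * Powers of a monomial ideal and faces of its Rees semigroup *)

Section MonomialPowers.
Variables (K : fieldType) (n : nat) (I : {pred {mpoly K[n]}}).
Variables (G : {pred 'X_{1..n}}).
Hypothesis IG : I =i mon_ideal G.
Implicit Types (v w : 'X_{1..n}).

(** The pairs [(j, w)] with ['X_[w]] in the [j]-th power of [I], by [ideal_pow_supp] and
    [mon_pow_ideal_pow]; they form the Rees semigroup. *)
Definition mon_pow (j : nat) (w : 'X_{1..n}) : Prop :=
  exists s : seq 'X_{1..n},
    [/\ size s = j, all (mem G) s & ((\sum_(v <- s) v)%MM <= w)%MM].

Lemma mon_pow0 : mon_pow 0 0%MM.
Proof. by exists [::]; split=> //; rewrite big_nil lepm_refl. Qed.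

Lemma mon_pow1 v : v \in G -> mon_pow 1 v.
Proof.
by move=> Gv; exists [:: v]; rewrite /= Gv; split=> //; rewrite big_seq1 lepm_refl.
Qed.

Lemma mon_powD i j v w :
  mon_pow i v -> mon_pow j w -> mon_pow (i + j) (v + w)%MM.
Proof.
move=> [s [<- sG sv]] [r [<- rG rw]]; exists (s ++ r).
split; [by rewrite size_cat | by rewrite all_cat sG | rewrite big_cat].
move/mnm_lepP: sv => sv; move/mnm_lepP: rw => rw.
by apply/mnm_lepP => c; rewrite !mnmDE leq_add.
Qed.

Lemma ideal_pow_supp j f w :
  f \in ideal_pow I j -> w \in msupp f -> mon_pow j w.
Proof.
have prodI (s : seq {mpoly K[n]}) v : all (mem I) s ->
    v \in msupp (\prod_(g <- s) g) -> mon_pow (size s) v.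
  elim: s v => [|g s IH] v /=.
    rewrite big_nil => _; rewrite [msupp 1]msupp1 mem_seq1 => /eqP ->.
    exact: mon_pow0.
  case/andP=> Ig sI; rewrite big_cons.
  move=> /msuppM_le/allpairsP[[v1 v2] /= [gv1 sv2 ->]].
  have : g \in mon_ideal G by rewrite -IG.
  move=> /mon_ideal_supp/(_ gv1)[v0 Gv0 v01].
  rewrite -(submK v01) -addmA addmC -add1n addmC [(_ + (_ + _))%MM]addmC.
  rewrite -[(1 + _)%N]/(0 + (1 + size s))%N addmC; apply: mon_powD.
    exists [::]; split=> //; rewrite big_nil.
    by apply/mnm_lepP => c; rewrite mnm0E.
  by apply: mon_powD; [apply: mon_pow1 | apply: IH].
move=> fI; move: w; elim/ideal_gen_ind: fI => [w|f1 f2 h1 h2 w|a g].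
- by rewrite msupp0.
- by move/msuppD_le; rewrite mem_cat => /orP[/h1|/h2].
move=> /asboolP[s sI ->] w /msuppM_le/allpairsP[[v1 v2] /= [_ gv2 ->]].
rewrite -[j]add0n; apply: mon_powD.
  exists [::]; split=> //; rewrite big_nil.
  by apply/mnm_lepP => c; rewrite mnm0E.
by rewrite -(size_tuple s); apply: prodI.
Qed.

Lemma mon_pow_ideal_pow j w : mon_pow j w -> 'X_[w] \in ideal_pow I j.
Proof.
move=> [s [<- sG sw]]; rewrite -(submK sw) mpolyXD; apply: ideal_genM.
apply: mem_ideal_gen; apply/asboolP.
exists (map_tuple (fun v => 'X_[v]) (in_tuple s)); last first.
  by rewrite big_map mprodXE.
rewrite all_map; apply: sub_all sG => v Gv /=.
by rewrite IG; apply: mon_idealX Gv (lepm_refl v).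
Qed.

Lemma mon_pow_mwt omega theta j w :
    (forall v, v \in G -> theta <= mwt omega v)%N -> mon_pow j w ->
  (theta * j <= mwt omega w)%N.
Proof.
move=> hG [s [<- sG sw]]; rewrite -(submK sw) mwtD.
apply: leq_trans (leq_addl _ _); elim: s sG {sw} => [|v s IH] /=.
  by rewrite muln0.
by case/andP=> Gv sG; rewrite big_cons mwtD mulnS leq_add ?hG ?IH.
Qed.

(** A face of the Rees semigroup: a sum lies in it exactly when both summands do. This is what makes
    projection to the face multiplicative. *)
Definition is_face (Q : nat -> 'X_{1..n} -> bool) : Prop :=
  Q 0%N 0%MM /\ forall i j v w, mon_pow i v -> mon_pow j w ->
    Q (i + j)%N (v + w)%MM = Q i v && Q j w.

(** The additive function [mwt omega w - theta * j] is nonnegative on the semigroup, so its zero set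
    is a face. *)
Lemma is_face_mwt omega theta :
    (forall v, v \in G -> theta <= mwt omega v)%N ->
  is_face (fun j w => mwt omega w == theta * j)%N.
Proof.
move=> hG; split=> [|i j v w iv jw]; first by rewrite mwt0 muln0.
have := mon_pow_mwt hG iv; have := mon_pow_mwt hG jw.
by rewrite mwtD mulnDr; lia.
Qed.

Lemma is_faceI Q1 Q2 :
  is_face Q1 -> is_face Q2 -> is_face (fun j w => Q1 j w && Q2 j w).
Proof.
move=> [Q10 Q1D] [Q20 Q2D]; split=> [|i j v w iv jw]; first by rewrite Q10.
by rewrite Q1D // Q2D // andbACA.
Qed.

Lemma is_face_forall (T : finType) (B : pred T) Q :
    (forall x, is_face (Q x)) ->
  is_face (fun j w => [forall x, B x ==> Q x j w]).
Proof.
move=> hQ; split=> [|i j v w iv jw].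
  by apply/forallP => x; rewrite (proj1 (hQ x)) implybT.
apply/forallP/andP => [h|[/forallP h1 /forallP h2] x]; last first.
  by rewrite (proj2 (hQ x)) //; have := h1 x; have := h2 x; case: (B x) => //= -> ->.
split; apply/forallP => x; apply/implyP => Bx; have := h x;
by rewrite Bx (proj2 (hQ x)) //= => /andP[].
Qed.

Section InitialForm.
Variable Q : nat -> 'X_{1..n} -> bool.

(** Projection of the Rees algebra onto the span of a face. It is a ring morphism into a domain, so
    its kernel is prime. *)
Definition init_form of I =i mon_ideal G & is_face Q : rees I -> {poly {mpoly K[n]}} :=
  fun p => \poly_(j < size (val p)) mtrunc (Q j) (val p)`_j.

Hypothesis fQ : is_face Q.

Lemma coef_init_form p j : (init_form IG fQ p)`_j = mtrunc (Q j) (val p)`_j.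
Proof.
by rewrite coef_poly; case: ltnP => // h; rewrite nth_default ?raddf0.
Qed.

Lemma init_form_coefE p j w :
  (init_form IG fQ p)`_j@_w = if Q j w then (val p)`_j@_w else 0.
Proof. by rewrite coef_init_form mcoeff_trunc. Qed.

Lemma rees_supp (p : rees I) j w : w \in msupp (val p)`_j -> mon_pow j w.
Proof. by case: p => p /= /asboolP hp; apply: ideal_pow_supp. Qed.

Fact init_form_is_zmod_morphism : zmod_morphism (init_form IG fQ).
Proof.
move=> p q; apply/polyP => j; rewrite coefB !coef_init_form.
by rewrite -raddfB -coefB.
Qed.

Fact init_form_is_monoid_morphism : monoid_morphism (init_form IG fQ).
Proof.
split=> [|p q]; apply/polyP => j.
  apply/mpolyP => w; rewrite init_form_coefE rmorph1 !coef1.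
  case: j => [|j] /=; last by rewrite mcoeff0 if_same.
  rewrite mcoeff1; have [->|_] := eqVneq w 0%MM; last by rewrite if_same.
  by rewrite (proj1 fQ).
rewrite coef_init_form rmorphM !coefM raddf_sum; apply: eq_bigr => i _.
rewrite !coef_init_form; apply: mtruncM => v w /rees_supp iv /rees_supp jw.
by rewrite -(proj2 fQ) // subnKC // -ltnS.
Qed.

HB.instance Definition _ := GRing.isZmodMorphism.Build
  (rees I) {poly {mpoly K[n]}} (init_form IG fQ) init_form_is_zmod_morphism.
HB.instance Definition _ := GRing.isMonoidMorphism.Build
  (rees I) {poly {mpoly K[n]}} (init_form IG fQ) init_form_is_monoid_morphism.

(** In degree 0 the face keeps only constant terms, and elements of the maximal ideal have none. *)
Lemma init_form_ext : (forall w, Q 0 w -> w = 0%MM) ->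
  forall p, p \in @rees_ext _ I (max_ideal K n) -> init_form IG fQ p = 0.
Proof.
move=> Q0 p; elim/ideal_gen_ind => [|p1 p2 h1 h2|q a /asboolP[f mf fE]].
- by rewrite rmorph0.
- by rewrite rmorphD /= h1 h2 addr0.
rewrite rmorphM /=; suff -> : init_form IG fQ a = 0 by rewrite mulr0.
apply/polyP => j; apply/mpolyP => w; rewrite init_form_coefE (coef_rees_const _ fE) coef0.
case: eqP => [->|_]; last by rewrite mcoeff0 if_same.
rewrite mcoeff0; case: ifP => // /Q0 ->.
elim/ideal_gen_ind: mf => [|f1 f2 h1 h2|b g /asboolP[c ->]].
- by rewrite mcoeff0.
- by rewrite mcoeffD h1 h2 addr0.
by rewrite rmorphM /= mcoeffX mnm1_eq0 mulr0.
Qed.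

End InitialForm.
End MonomialPowers.

(** * Chains of primes *)

Section KrullDimension.
Local Open Scope quotient_scope.
Variables (A : comNzRingType) (J : idealr A).

Definition prime_chain (B : comNzRingType) (l : nat) : Prop :=
  exists P : 'I_l.+1 -> prime_idealr B, forall i j : 'I_l.+1, (i < j)%N ->
    {subset P i <= P j} /\ ~ {subset P j <= P i}.

Lemma prime_chain_kernels (D : idomainType) l (phi : nat -> {rmorphism A -> D}) :
    (forall m x, x \in J -> phi m x = 0) ->
    (forall m m' x, (m <= m')%N -> phi m x = 0 -> phi m' x = 0) ->
    (forall m, (m < l)%N -> exists2 x, phi m.+1 x = 0 & phi m x != 0) ->
  prime_chain {ideal_quot J} l.
Proof.
move=> phiJ mono strict.
exists (fun m : 'I_l.+1 => quot_ker (phiJ m) : prime_idealr {ideal_quot J}).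
move=> i j ij; split=> [x|sub].
  rewrite -[x]reprK !quot_kerE => /eqP h; apply/eqP.
  by apply: mono h; apply: ltnW.
have [x x0 xN0] : exists2 x, phi i.+1 x = 0 & phi i x != 0.
  by apply: strict; have := ltn_ord j; lia.
case/negP: xN0; rewrite -(quot_kerE (phiJ i)); apply: sub.
by rewrite quot_kerE; apply/eqP; apply: mono x0.
Qed.

(** A longer chain yields [n.+1] elements [a k] as in [krull_independence]. The images under [phi]
    of their representatives are algebraically dependent, and since the kernel of [phi] lies in [J]
    the relation holds in the quotient, a contradiction. *)
Lemma prime_chain_leq (K : fieldType) n (kappa : {rmorphism K -> A})
    (phi : {rmorphism A -> {mpoly K[n]}}) l :
    (forall a, phi (kappa a) = a%:MP) ->
    (forall x, phi x = 0 -> x \in J) ->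
  prime_chain {ideal_quot J} l -> (l <= n)%N.
Proof.
move=> phi_kappa kerJ [P chain]; rewrite leqNgt; apply/negP => nl.
have /boolp.choice[a ha] (k : 'I_n.+1) : exists x,
    x \in P (inord k.+1) /\ x \notin P (inord k).
  have kl : (k.+1 < l.+1)%N by have := ltn_ord k; lia.
  have [|_ h] := chain (inord k) (inord k.+1).
    by rewrite !inordK // ltnW.
  apply: contrapT => h'; apply: h => x Px; apply: contrapT => /negP xN.
  by apply: h'; exists x.
pose b k := phi (repr (a k)).
have [N [c [[nu /eqP cnu] rel]]] := algebraic_dependence b.
apply: cnu; move: nu.
pose kap := \pi_{ideal_quot J} \o kappa.
apply: (@krull_independence _ _ kap _ _ (fun k => P (inord k)) a).
- exact: ha.
- move=> k kn; case: (chain (inord k) (inord k.+1)) => //.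
  by rewrite !inordK; lia.
have -> : \sum_nu kap (c nu) * \prod_i a i ^+ nu i =
    \pi_{ideal_quot J} (\sum_nu kappa (c nu) * \prod_i repr (a i) ^+ nu i).
  rewrite rmorph_sum; apply: eq_bigr => nu _; rewrite rmorphM rmorph_prod.
  by congr (_ * _); apply: eq_bigr => i _; rewrite rmorphXn /= reprK.
rewrite -[RHS](rmorph0 (\pi_{ideal_quot J})); apply/eqP.
rewrite -Quotient.idealrBE subr0; apply: kerJ; rewrite -[RHS]rel rmorph_sum.
apply: eq_bigr => nu _; rewrite rmorphM phi_kappa mul_mpolyC rmorph_prod.
by congr (_ *: _); apply: eq_bigr => i _; rewrite rmorphXn.
Qed.

End KrullDimension.

(** * Homogeneous elements of the Rees algebra *)

Section ReesMonomials.
Variables (R : comNzRingType) (I : {pred R}).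

Lemma ideal_pow0 (f : R) : f \in ideal_pow I 0.
Proof.
rewrite -[f]mulr1; apply: ideal_genM; apply: mem_ideal_gen; apply/asboolP.
by exists [tuple]; rewrite ?big_nil.
Qed.

(** The default value 0 is taken if [f%:P * 'X^j] is outside the Rees algebra, whence the membership
    hypotheses below. *)
Definition rees_mon j (f : R) : rees I := insubd (0 : rees I) (f%:P * 'X^j).

Lemma val_rees_mon j f : f \in ideal_pow I j -> val (rees_mon j f) = f%:P * 'X^j.
Proof.
move=> fI; rewrite insubdK //; apply/asboolP => i.
rewrite coefCM coefXn; have [->|_] := eqVneq; first by rewrite mulr1.
by rewrite mulr0 ideal_gen0.
Qed.

Lemma coef_rees_mon j f i : f \in ideal_pow I j ->
  (val (rees_mon j f))`_i = if i == j then f else 0.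
Proof.
move=> fI; rewrite val_rees_mon // coefCM coefXn.
by case: eqP; rewrite ?mulr1 ?mulr0.
Qed.

Lemma rees_monB j f g : f \in ideal_pow I j -> g \in ideal_pow I j ->
  rees_mon j (f - g) = rees_mon j f - rees_mon j g.
Proof.
move=> fI gI; apply: val_inj; rewrite rmorphB /= !val_rees_mon //.
  by rewrite -mulrBl -polyCB.
by rewrite -mulN1r; apply: ideal_genD => //; apply: ideal_genM.
Qed.

Lemma rees_mon_sum j (T : eqType) (s : seq T) (f : T -> R) :
    (forall x, x \in s -> f x \in ideal_pow I j) ->
  rees_mon j (\sum_(x <- s) f x) = \sum_(x <- s) rees_mon j (f x).
Proof.
move=> fI; apply: val_inj; rewrite rmorph_sum /= val_rees_mon; last first.
  rewrite big_seq; elim/big_ind: _ => [||x]; last exact: fI.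
    exact: ideal_gen0.
  exact: ideal_genD.
rewrite rmorph_sum mulr_suml; apply: eq_big_seq => x xs.
by rewrite -val_rees_mon ?fI.
Qed.

Lemma rees_monE (p : rees I) : p = \sum_(j < size (val p)) rees_mon j (val p)`_j.
Proof.
apply: val_inj; rewrite rmorph_sum /= -[LHS]coefK poly_def.
apply: eq_bigr => j _; rewrite -mul_polyC -val_rees_mon //.
by case: p j => p /= /asboolP.
Qed.

Lemma rees_mon_ext (m : idealr R) j (a f : R) :
  a \in m -> f \in ideal_pow I j -> rees_mon j (a * f) \in @rees_ext _ I m.
Proof.
move=> ma fI; have -> : rees_mon j (a * f) = rees_mon j f * rees_mon 0 a.
  apply: val_inj; rewrite rmorphM /= !val_rees_mon ?ideal_pow0 //.
    by rewrite expr0 mulr1 polyCM -mulrA mulrC.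
  exact: ideal_genM.
apply: ideal_genM; apply: mem_ideal_gen; apply/asboolP; exists a => //.
by rewrite val_rees_mon ?ideal_pow0 // mulr1.
Qed.

Definition rees_const (a : R) : rees I := rees_mon 0 a.

Lemma val_rees_const a : val (rees_const a) = a%:P.
Proof. by rewrite val_rees_mon ?ideal_pow0 // mulr1. Qed.

Fact rees_const_is_zmod_morphism : zmod_morphism rees_const.
Proof. by move=> a b; rewrite /rees_const rees_monB // ideal_pow0. Qed.

Fact rees_const_is_monoid_morphism : monoid_morphism rees_const.
Proof.
split=> [|a b]; apply: val_inj; rewrite ?(rmorph1, rmorphM) /=.
  by rewrite val_rees_const.
by rewrite !val_rees_const polyCM.
Qed.

HB.instance Definition _ := GRing.isZmodMorphism.Build R (rees I) rees_const
  rees_const_is_zmod_morphism.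
HB.instance Definition _ := GRing.isMonoidMorphism.Build R (rees I) rees_const
  rees_const_is_monoid_morphism.

End ReesMonomials.

(** * Fiber rings of equigenerated monomial ideals *)

Section EquigeneratedFiberRing.
Variables (K : fieldType) (n d : nat) (I : {pred {mpoly K[n]}}).
Variable G : {pred 'X_{1..n}}.
Hypotheses (IG : I =i mon_ideal G) (d_gt0 : (0 < d)%N).
Hypothesis mdegG : forall v, v \in G -> mdeg v = d.

Lemma is_face_mdeg : is_face G (fun j w => mdeg w == d * j)%N.
Proof.
have [] := @is_face_mwt _ G (fun=> 1%N) d => [v Gv|Q0 QD].
  by rewrite mwt_const mdegG.
split=> [|i j v w iv jw]; first by rewrite mdeg0 muln0.
by have := QD _ _ _ _ iv jw; rewrite !mwt_const.
Qed.

Let top := init_form IG is_face_mdeg.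

(** A surviving term in degree [j] does not have degree [d * j], so it is a proper multiple of a
    product of [j] generators. Some variable divides the cofactor, which puts the term in the
    extension of the maximal ideal. *)
Lemma init_form_mdeg_ker p : top p = 0 -> p \in @rees_ext _ I (max_ideal K n).
Proof.
move=> p0; rewrite (rees_monE p); apply: rpred_sum => j _.
rewrite [(val p)`_j]mpolyE rees_mon_sum => [|w wp]; last first.
  rewrite -mul_mpolyC; apply/ideal_genM/(mon_pow_ideal_pow IG).
  exact: (rees_supp IG) wp.
rewrite big_seq; apply: rpred_sum => w wp.
have [s [sj sG sw]] := rees_supp IG wp.
have wNdj : (mdeg w == d * j)%N = false.
  apply: contraTF wp => dw; rewrite -mcoeff_eq0.
  by have := init_form_coefE IG is_face_mdeg p j w; rewrite [init_form _ _ p]p0 coef0 mcoeff0 dw => <-.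
have ds : mdeg (\sum_(v <- s) v)%MM = (d * j)%N.
  rewrite -sj mdeg_sum; elim: s sG {sj sw} => [|v s IH] /=.
    by rewrite big_nil muln0.
  by case/andP=> Gv sG; rewrite big_cons mulnS IH // mdegG.
have [c cw] : exists c, (w - \sum_(v <- s) v)%MM c != 0%N.
  apply: contrapT => h; move/negP: wNdj; apply; rewrite -ds -(submK sw) mdegD.
  rewrite [X in (X + _)%N == _](_ : _ = 0%N) //; apply/eqP; rewrite mdeg_eq0.
  apply/eqP/mnmP => c; rewrite mnm0E; apply/eqP; apply: contrapT => /negP hc.
  by apply: h; exists c.
rewrite -lep1mP in cw.
have wE : w = (U_(c) + (w - \sum_(v <- s) v - U_(c) + \sum_(v <- s) v))%MM.
  by rewrite addmA [(U_(c) + _)%MM]addmC submK // submK.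
rewrite [in 'X_[w]]wE mpolyXD scalerAr; apply: rees_mon_ext.
  by apply: mem_ideal_gen; apply/asboolP; exists c.
rewrite -mul_mpolyC; apply/ideal_genM/(mon_pow_ideal_pow IG).
by exists s; split=> //; apply: lem_addl.
Qed.

(** On this face [j] is determined by [mdeg w = d * j], as [d > 0]; distinct coefficients have
    disjoint supports and cannot cancel at 1. *)
Lemma init_form_mdeg_eval p : (top p).[1] = 0 -> top p = 0.
Proof.
move=> p1; apply/polyP => j; apply/mpolyP => w; rewrite coef0 mcoeff0.
rewrite [LHS]init_form_coefE; case: eqP => // dw.
have := congr1 (mcoeff w) p1; rewrite horner_coef mcoeff0 raddf_sum /=.
under eq_bigr do rewrite expr1n mulr1.
case: (ltnP j (size (top p))) => [js|js _]; last first.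
  have := init_form_coefE IG is_face_mdeg p j w.
  by rewrite dw eqxx => <-; rewrite [X in X@_w]nth_default ?mcoeff0.
rewrite (bigD1 (Ordinal js)) //= big1 ?addr0 => [|i ij].
  by rewrite [X in X = _ -> _]init_form_coefE dw eqxx.
rewrite [LHS]init_form_coefE dw eqn_pmul2l // ifN // eq_sym.
by apply: contra ij => /eqP ij; apply/eqP/val_inj.
Qed.

Lemma init_form_mdeg_const a : top (rees_const I a%:MP) = (a%:MP)%:P.
Proof.
apply/polyP => j; apply/mpolyP => w; rewrite [LHS]init_form_coefE.
rewrite (coef_rees_const _ (val_rees_const _ _)) coefC; case: (j =P 0%N) => [->|_].
  by rewrite mcoeffC -mdeg_eq0 muln0; case: eqP; rewrite ?mulr0.
by rewrite mcoeff0 if_same.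
Qed.

(** By the preceding lemmas, [top] followed by evaluation at 1 has its kernel inside the extension
    of the maximal ideal. *)
Lemma fiber_prime_chain_leq l :
  prime_chain (fiber_ring I (max_ideal K n)) l -> (l <= n)%N.
Proof.
apply: (@prime_chain_leq _ (@rees_ext _ I (max_ideal K n)) K n
  (rees_const I \o @mpolyC n K) (horner_eval 1 \o top)) => [a|p] /=.
  by rewrite /horner_eval [init_form _ _ _]init_form_mdeg_const hornerC.
by move=> p0; apply/init_form_mdeg_ker/init_form_mdeg_eval.
Qed.

(** Shrinking faces have growing kernels; a generator [v] lost between two faces gives the element
    [rees_mon I 1 'X_[v]] of the larger kernel only. *)
Lemma face_chain_prime_chain (Q : nat -> nat -> 'X_{1..n} -> bool) l :
    (forall m, is_face G (Q m)) ->
    (forall m j w, Q m j w -> mdeg w == d * j)%N ->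
    (forall m m' j w, (m <= m')%N -> Q m' j w -> Q m j w) ->
    (forall m, (m < l)%N -> exists2 v, v \in G & Q m 1%N v && ~~ Q m.+1 1%N v) ->
  prime_chain (fiber_ring I (max_ideal K n)) l.
Proof.
move=> fQ Qdeg mono strict.
apply: (@prime_chain_kernels _ (@rees_ext _ I (max_ideal K n)) _ _
  (fun m => init_form IG (fQ m))) => [m p|m m' p mm' p0|m /strict].
- apply: init_form_ext => w /Qdeg; rewrite muln0 mdeg_eq0 => /eqP //.
- apply/polyP => j; apply/mpolyP => w; rewrite coef0 mcoeff0.
  rewrite [LHS]init_form_coefE; case: ifP => // /(mono _ _ _ _ mm') Qw.
  have := init_form_coefE IG (fQ m) p j w.
  by rewrite Qw [init_form _ _ _]p0 coef0 mcoeff0.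
case=> v Gv /andP[Qv /negPf NQv].
have Iv := mon_pow_ideal_pow IG (mon_pow1 Gv).
exists (rees_mon I 1 'X_[v]).
  apply/polyP => j; apply/mpolyP => w; rewrite coef0 mcoeff0.
  rewrite [LHS]init_form_coefE coef_rees_mon //; case: (j =P 1%N) => [->|_].
    by rewrite mcoeffX; case: eqP => [<-|_]; rewrite ?NQv ?if_same.
  by rewrite mcoeff0 if_same.
apply/negP => /eqP x0.
have := init_form_coefE IG (fQ m) (rees_mon I 1 'X_[v]) 1 v.
rewrite [init_form _ _ _]x0 coef0 mcoeff0 Qv coef_rees_mon // mcoeffX eqxx.
by move/eqP; rewrite eq_sym oner_eq0.
Qed.

End EquigeneratedFiberRing.

(** * Spread sequences *)

(* Everything is counted from 0: the paper's d, n and i_(a+1) are d.+1, n.+1 and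
   (ii a).+1. *)
Section Sequences.
Variables (n d t : nat) (ii : nat -> nat).
Local Notation N := n.+1.

Definition seq_mnm (f : nat -> nat) : 'X_{1..N} :=
  (\sum_(a < d.+1) U_(inord (f a)))%MM.

Lemma eq_seq_mnm f g :
  (forall a, (a <= d)%N -> f a = g a) -> seq_mnm f = seq_mnm g.
Proof. by move=> fg; apply: eq_bigr => a _; rewrite fg // -ltnS. Qed.

Lemma mdeg_seq_mnm f : mdeg (seq_mnm f) = d.+1.
Proof.
rewrite mdeg_sum (eq_bigr (fun=> 1%N)) => [|a _]; last by rewrite mdeg1.
by rewrite sum1_card card_ord.
Qed.

Lemma seq_mnm_eq0 f c :
    (forall a, (a <= d)%N -> f a <= n)%N ->
    (forall a, (a <= d)%N -> f a != c) -> (c <= n)%N ->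
  seq_mnm f (inord c) = 0%N.
Proof.
move=> fn fc cn; rewrite mnm_sumE big1 // => a _; rewrite mnm1E.
have ad : (a <= d)%N by rewrite -ltnS.
by rewrite -val_eqE /= !inordK ?ltnS ?fn // (negPf (fc a ad)).
Qed.

Lemma seq_mnm_eq1 f a :
    (forall b, (b <= d)%N -> f b <= n)%N ->
    (forall b, (b <= d)%N -> f b = f a -> b = a) -> (a <= d)%N ->
  seq_mnm f (inord (f a)) = 1%N.
Proof.
move=> fn finj ad; rewrite mnm_sumE.
have ad1 : (a < d.+1)%N by [].
rewrite (bigD1 (Ordinal ad1)) //= mnm1E eqxx big1 ?addn0 // => b ba.
have bd : (b <= d)%N by rewrite -ltnS.
rewrite mnm1E -val_eqE /= !inordK ?ltnS ?fn //.
by case: eqP => // /finj e; case/eqP: ba; apply: val_inj; rewrite /= e.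
Qed.

Lemma tspread_seq_mnm f :
    (forall a, (a <= d)%N -> f a <= n)%N ->
    (forall a, (a < d)%N -> f a + t <= f a.+1)%N ->
  tspread t (seq_mnm f).
Proof.
move=> fn fS; exists (mkseq (fun a => inord (f a) : 'I_N) d.+1); last first.
  by rewrite mnm_sum_mkseq.
apply/(sortedP (inord 0 : 'I_N)) => a; rewrite size_mkseq ltnS => ad.
rewrite !nth_mkseq ?ltnS //; last exact: ltnW.
rewrite !inordK ?ltnS ?fn //; last exact: ltnW.
by have := fS a ad; lia.
Qed.

(** The indices of the generator with [c] in slot [k]: as small as possible before it, those of [u]
    after it. *)
Definition slot_seq k c a := if (a < k)%N then (a * t)%N else
  if a == k then c else ii a.

Definition slot_rest k : 'X_{1..N} :=
  (\sum_(a < d.+1 | a != k :> nat)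
      U_(inord (if (a < k)%N then (a * t)%N else ii a)))%MM.

Lemma seq_mnm_slot k c : (k <= d)%N ->
  seq_mnm (slot_seq k c) = (U_(inord c) + slot_rest k)%MM.
Proof.
move=> kd; have kd1 : (k < d.+1)%N by [].
rewrite /seq_mnm (bigD1 (Ordinal kd1)) //=.
congr (_ + _)%MM; first by rewrite /slot_seq ltnn eqxx.
by apply: eq_bigr => a ak; rewrite /slot_seq (negPf (ak : a != k :> nat)).
Qed.

Definition socle_mnm : 'X_{1..N} :=
  (\sum_(k < d.+1) slot_rest k + \sum_(l < d) U_(inord (ii l)))%MM.

Lemma mdeg_socle_mnm : (mdeg socle_mnm).+1 = (d.+1 * d.+1)%N.
Proof.
have rest k : (k <= d)%N -> mdeg (slot_rest k) = d.
  move=> kd; have := mdeg_seq_mnm (slot_seq k 0).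
  by rewrite seq_mnm_slot // mdegD mdeg1 add1n => -[].
rewrite mdegD !mdeg_sum (eq_bigr (fun=> d)) => [|k _]; last by rewrite rest // -ltnS.
rewrite [X in (_ + X)%N](eq_bigr (fun=> 1%N)) => [|k _]; last by rewrite mdeg1.
by rewrite !sum_nat_const !card_ord; lia.
Qed.

(* In x_j * socle, the d.+1 slots are filled by i_0 < ... < i_(d-1) with j
   inserted at its place k. *)
Lemma socle_mnmE k j : (k <= d)%N -> let c l :=
    if (l < k)%N then ii l else if l == k then j else ii l.-1 in
  (U_(inord j) + socle_mnm = \sum_(l < d.+1) seq_mnm (slot_seq l (c l)))%MM.
Proof.
move=> kd c; have kd1 : (k < d.+1)%N by [].
rewrite (eq_bigr (fun l : 'I_d.+1 => U_(inord (c l)) + slot_rest l)%MM); last first.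
  by move=> l _; rewrite seq_mnm_slot // -ltnS.
rewrite big_split /= [RHS]addmC /socle_mnm addmA [(U_(_) + _)%MM]addmC -addmA.
congr (_ + _)%MM; rewrite (bigD1_ord (Ordinal kd1)) //=; congr (_ + _)%MM.
  by rewrite /c ltnn eqxx.
apply: eq_bigr => l _; rewrite /c /= /bump; case: (leqP k l) => kl.
  by rewrite add1n ltnNge leqW //= gtn_eqF.
by rewrite add0n kl.
Qed.

(** Step [m] imposes the condition for every [c >= n - m]. As the total degree is [d.+1 * j], weight
    [d * j] away from one variable means that this variable has exponent [j]. The factor [0 * j]
    matches the form of [is_face_mwt], and the last clause leaves only the origin once [m > n]. *)
Definition chain_face (m j : nat) (w : 'X_{1..N}) : bool :=
  [&& mdeg w == (d.+1 * j)%N,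
    [forall c : 'I_N, ((n - m <= c)%N && [forall a : 'I_d.+1, ii a != c]) ==>
       (mwt (pred1 c : pred _) w == 0 * j)%N],
    [forall a : 'I_d, (n - m <= ii a)%N ==>
       (mwt (predC1 (inord (ii a.+1) : 'I_N) : pred _) w == d * j)%N] &
    (n < m)%N ==> (j == 0)%N].

Lemma chain_face_mono m m' j w :
  (m <= m')%N -> chain_face m' j w -> chain_face m j w.
Proof.
move=> mm' /and4P[h0 /forallP h1 /forallP h2 h3]; apply/and4P; split=> //.
- apply/forallP => c; apply/implyP => /andP[mc hc]; have := h1 c.
  by rewrite hc andbT; move/implyP; apply; lia.
- by apply/forallP => a; apply/implyP => ma; have /implyP := h2 a; apply; lia.
- by apply/implyP => nm; apply: (implyP h3); lia.
Qed.

Hypothesis iiS : forall a, (a < d)%N -> (ii a + t <= ii a.+1)%N.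

Lemma seq_lt a b : (a < b)%N -> (b <= d)%N -> (ii a + t <= ii b)%N.
Proof.
elim: b => // b IH; rewrite ltnS leq_eqVlt => /orP[/eqP ->|ab] bd.
  exact: iiS.
by have := IH ab (ltnW bd); have := iiS bd; lia.
Qed.

Lemma slot_seqS k c a : (k <= d)%N -> (k * t <= c)%N -> (c <= ii k)%N ->
  (a < d)%N -> (slot_seq k c a + t <= slot_seq k c a.+1)%N.
Proof.
move=> kd kc ck ad; rewrite /slot_seq.
have hS : (a * t + t = a.+1 * t)%N by rewrite mulSn addnC.
case: (ltngtP a k) => [ak|ka|ak].
- case: (ltngtP a.+1 k) => [ak'|ka|e]; first by rewrite hS.
    by rewrite ltnNge ak in ka.
  by rewrite hS e.
- have -> : (a.+1 < k)%N = false by apply/negbTE; rewrite -leqNgt leqW // ltnW.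
  by rewrite gtn_eqF ?leqW //; apply: iiS.
- rewrite ltnNge ak leqnSn /= gtn_eqF //; apply: leq_trans (iiS _).
    by rewrite leq_add2r.
  by rewrite -ak.
Qed.

Hypothesis ii0 : (t <= ii 0)%N.

(** The bound [t <= ii 0] enters here: it lets [ii a] move up into slot [a.+1], whose least
    admissible value is [a.+1 * t]. *)
Lemma seq_ge a : (a <= d)%N -> (a.+1 * t <= ii a)%N.
Proof.
elim: a => [|a IH] ad; first by rewrite mul1n.
by rewrite mulSn; have := IH (ltnW ad); have := iiS ad; lia.
Qed.

Lemma slot_seq_le k c a : (k * t <= c)%N -> (c <= ii k)%N -> (a <= d)%N ->
  (slot_seq k c a <= ii a)%N.
Proof.
move=> kc ck ad; rewrite /slot_seq; case: ltnP => _.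
  by have := seq_ge ad; rewrite mulSn; lia.
by case: eqP => // ->.
Qed.

Hypotheses (t_gt0 : (0 < t)%N) (iid : ii d = n).

Lemma seq_inj a b : (a <= d)%N -> (b <= d)%N -> ii a = ii b -> a = b.
Proof.
move=> ad bd e; case: (ltngtP a b) => // h.
  by have := seq_lt h bd; lia.
by have := seq_lt h ad; lia.
Qed.

Lemma seq_le_last a : (a <= d)%N -> (ii a <= n)%N.
Proof.
rewrite -iid leq_eqVlt => /orP[/eqP -> //|ad].
by apply: leq_trans (seq_lt ad (leqnn d)); apply: leq_addr.
Qed.

(** For [m = n] the witness is [u]. Otherwise step [m.+1] adds the condition for [c0 = n - m.+1],
    and the witness has [c0] in slot [k], the first slot with [c0 < ii k]. *)
Lemma chain_face_strict m : (m <= n)%N -> exists f,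
  [/\ forall a, (a <= d)%N -> (f a <= ii a)%N,
      forall a, (a < d)%N -> (f a + t <= f a.+1)%N,
      chain_face m 1 (seq_mnm f) & ~~ chain_face m.+1 1 (seq_mnm f)].
Proof.
have wtE (e : 'I_N) w : mdeg w = d.+1 -> (mwt (predC1 e : pred _) w == d) = (w e == 1%N).
  by have := mwt_predC1 e w; lia.
rewrite leq_eqVlt => /orP[/eqP ->|mn].
  exists ii; split=> //; last by rewrite /chain_face ltnSn /= !andbF.
  rewrite /chain_face mdeg_seq_mnm muln1 eqxx ltnn /= andbT.
  apply/andP; split; [apply/forallP => c|apply/forallP => a]; apply/implyP.
    case/andP=> _ /forallP hc; rewrite mwt_pred1 mul0n -[c]inord_val.
    apply/eqP; apply: seq_mnm_eq0; [exact: seq_le_last | | by rewrite -ltnS].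
    by move=> b bd; have := hc (inord b); rewrite inordK.
  move=> _; rewrite muln1 wtE ?mdeg_seq_mnm //; apply/eqP.
  apply: seq_mnm_eq1 => //; [exact: seq_le_last | by move=> b bd; apply: seq_inj].
pose c0 := (n - m.+1)%N.
have ex : exists k, (k <= d)%N && (c0 < ii k)%N.
  by exists d; rewrite leqnn iid /c0; lia.
case: (ex_minnP ex) => k /andP[kd c0k] mink.
have lek l : (l < k)%N -> (ii l <= c0)%N.
  move=> lk; rewrite leqNgt; apply/negP => h.
  by have := mink l; rewrite h (leq_trans (ltnW lk) kd) /= leqNgt lk => /(_ isT).
have kc0 : (k * t <= c0)%N.
  case: k kd lek {c0k mink} => // k kd lek.
  by apply: leq_trans (lek k (ltnSn k)); apply: seq_ge; apply: ltnW.
have fle a (ad : (a <= d)%N) := slot_seq_le kc0 (ltnW c0k) ad.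
have fS a (ad : (a < d)%N) := slot_seqS kd kc0 (ltnW c0k) ad.
pose f := slot_seq k c0.
have fn a : (a <= d)%N -> (f a <= n)%N.
  by move=> ad; apply: leq_trans (fle _ ad) (seq_le_last ad).
(* The entries up to slot [k] are at most [c0] and the later ones are those of [ii], so all
   conditions for indices above [c0] hold. *)
have flow a : (a <= k)%N -> (f a <= c0)%N.
  move=> ak; rewrite /f /slot_seq; case: ltngtP ak => // ak _.
  by apply: leq_trans kc0; rewrite leq_mul2r ltnW ?orbT.
have fhigh a : (k < a)%N -> f a = ii a.
  by move=> ka; rewrite /f /slot_seq ltnNge ltnW //= gtn_eqF.
exists f; split=> //.
- rewrite /chain_face mdeg_seq_mnm muln1 eqxx ltnNge ltnW //= andbT.
  apply/andP; split; [apply/forallP => c|apply/forallP => a]; apply/implyP.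
    case/andP=> mc /forallP hc; rewrite mwt_pred1 mul0n -[c]inord_val.
    apply/eqP; apply: seq_mnm_eq0 => // [b bd|]; last by rewrite -ltnS.
    have [/flow bk|/fhigh ->] := leqP b k; first by rewrite neq_ltn /c0 in bk *; lia.
    by have := hc (inord b); rewrite inordK.
  move=> ma; rewrite muln1 wtE ?mdeg_seq_mnm //; apply/eqP.
  have ad := ltn_ord a.
  have ka : (k < a.+1)%N.
    by rewrite ltnS leqNgt; apply/negP => /lek; rewrite /c0; lia.
  rewrite -(fhigh _ ka); apply: seq_mnm_eq1 => // b bd.
  have [/flow bk|/fhigh ->] := leqP b k; rewrite (fhigh _ ka) => h.
    by have := seq_lt (ltnSn a) ad; rewrite /c0 in bk *; lia.
  by apply: seq_inj h.
(* If [c0 = ii a], then [k = a.+1] and the required variable of index [ii k] is missing; otherwise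
   the forbidden variable of index [c0] occurs. *)
have [/existsP[a /eqP ac]|/existsPn hc] := boolP [exists a : 'I_d.+1, ii a == c0].
  have ak : (a < k)%N.
    rewrite ltnNge; apply/negP; rewrite leq_eqVlt => /orP[/eqP e|ka].
      by rewrite e ac ltnn in c0k.
    by have := seq_lt ka (ltn_ord a); lia.
  have aE : a.+1 = k.
    apply/eqP; rewrite eqn_leq ak /= leqNgt; apply/negP => h.
    by have := seq_lt (ltnSn a) (leq_trans (ltnW h) kd); have := lek _ h; lia.
  have ad : (a < d)%N by rewrite aE.
  apply/negP => /and4P[_ _ /forallP/(_ (Ordinal ad)) h _]; move: h.
  rewrite /= ac leqnn /= muln1 wtE ?mdeg_seq_mnm // aE seq_mnm_eq0 //.
    move=> b bd; have [/flow bk|kb] := leqP b k; first by lia.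
    by rewrite fhigh // gtn_eqF //; have := seq_lt kb bd; lia.
  exact: seq_le_last.
have c0n : (c0 <= n)%N by rewrite leq_subr.
apply/negP => /and4P[_ /forallP/(_ (inord c0)) h _ _]; move: h.
have fk : f k = c0 by rewrite /f /slot_seq ltnn eqxx.
rewrite inordK ?ltnS // leqnn mwt_pred1 -{2}fk seq_mnm_eq1 //.
  by rewrite implybF /= => /negP; apply; apply/forallP.
move=> b bd; rewrite fk => bc; apply/eqP; rewrite eqn_leq; apply/andP; split.
  by rewrite leqNgt; apply/negP => kb; have := fhigh _ kb; have := seq_lt kb bd; lia.
rewrite leqNgt; apply/negP => bk; have : (b.+1 * t <= k * t)%N by rewrite leq_mul2r bk orbT.
by move: bc; rewrite /f /slot_seq bk mulSn; lia.
Qed.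

End Sequences.

(** * The principal Borel ideal *)

Section SpreadBorelIdeal.
Variables (K : fieldType) (n d t : nat) (ii : nat -> nat).
Local Notation N := n.+1.
Hypotheses (t_gt0 : (0 < t)%N) (ii0 : (t <= ii 0)%N) (iid : ii d = n).
Hypothesis iiS : forall a, (a < d)%N -> (ii a + t <= ii a.+1)%N.
Variable I : {pred {mpoly K[N]}}.
Local Notation u := (seq_mnm n d ii).
Hypothesis borelI : is_tspread_principal_borel t u I.
Local Notation G := (borel_gens t u I).

Let ii_le a (ad : (a <= d)%N) := seq_le_last iiS iid ad.
Let tu : tspread t u := tspread_seq_mnm ii_le iiS.
Let IG : I =i mon_ideal G := borel_gensE tu borelI.

Lemma mdeg_borel_gens v : v \in G -> mdeg v = d.+1.
Proof. by case/asboolP => _ -> _; apply: mdeg_seq_mnm. Qed.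

(* The i_k are lowered to f k one at a time, in increasing order of k. *)
Lemma seq_mnm_borel_gens f :
    (forall a, (a <= d)%N -> f a <= ii a)%N ->
    (forall a, (a < d)%N -> f a + t <= f a.+1)%N ->
  seq_mnm n d f \in G.
Proof.
move=> fle fS; pose h k a := if (a < k)%N then f a else ii a.
have hle k a : (a <= d)%N -> (h k a <= n)%N.
  by move=> ad; rewrite /h; case: ifP => _; rewrite ?ii_le ?(leq_trans (fle a ad)) ?ii_le.
have hS k a : (a < d)%N -> (h k a + t <= h k a.+1)%N.
  move=> ad; rewrite /h; have := fle a (ltnW ad); have := fS a ad; have := iiS ad.
  by case: ifP => ak; case: ifP => ak' //; lia.
suff hk k : (k <= d.+1)%N -> seq_mnm n d (h k) \in G.
  by rewrite (@eq_seq_mnm n d f (h d.+1)) ?hk // => a ad; rewrite /h ltnS ad.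
elim: k => [_|k IH kd].
  rewrite (@eq_seq_mnm n d (h 0) ii) //; apply/asboolP; split=> //.
  by case: borelI.
have {}IH := IH (ltnW kd); rewrite ltnS in kd.
(* An exchange needs a strictly smaller index; if the two agree, nothing changes. *)
have [e|fNi] := eqVneq (f k) (ii k).
  rewrite (@eq_seq_mnm n d (h k.+1) (h k)) // => a _; rewrite /h ltnS leq_eqVlt.
  by case: eqP => [->|//]; rewrite ltnn.
have kd1 : (k < d.+1)%N by [].
have hkD m : seq_mnm n d (h m) = (U_(inord (h m k)) +
    \sum_(a < d.+1 | a != Ordinal kd1) U_(inord (h m a)))%MM.
  by rewrite /seq_mnm (bigD1 (Ordinal kd1)).
have hkk : h k k = ii k by rewrite /h ltnn.
have hkSk : h k.+1 k = f k by rewrite /h ltnSn.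
have E : seq_mnm n d (h k.+1) =
    (seq_mnm n d (h k) - U_(inord (ii k)) + U_(inord (f k)))%MM.
  rewrite !hkD hkk hkSk addmC [(U_(inord (ii k)) + _)%MM]addmC addmK.
  congr (_ + _)%MM; apply: eq_bigr => a ak; rewrite /h ltnS leq_eqVlt.
  by rewrite (negPf (ak : a != k :> nat)).
rewrite E; apply: borel_gens_exchange => //; rewrite -?E.
- by rewrite hkD hkk mnmDE mnm1E eqxx.
- rewrite !inordK ?ltnS ?ii_le ?(leq_trans (fle k kd)) ?ii_le //.
  by rewrite ltn_neqAle fNi fle.
- by apply: tspread_seq_mnm => // a; [apply: hle | apply: hS].
Qed.

Lemma mon_pow_sum j (s : seq nat) (f : nat -> 'X_{1..N}) :
    size s = j -> (forall l, l \in s -> f l \in G) ->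
  mon_pow G j (\sum_(l <- s) f l)%MM.
Proof.
move=> <- fG; exists (map f s); rewrite size_map big_map lepm_refl; split=> //.
by apply/allP => v /mapP[l ls ->]; apply: fG.
Qed.

(** Insert [c] at the first [k] with [c <= ii k]. Each slot [l] then receives a value between
    [l * t] and [ii l], so every factor is a generator. *)
Lemma socle_mnm_mon_pow (c : 'I_N) :
  mon_pow G d.+1 (U_(c) + socle_mnm n d t ii)%MM.
Proof.
have ex : exists k, (k <= d)%N && (c <= ii k)%N.
  by exists d; rewrite leqnn iid -ltnS /=.
case: (ex_minnP ex) => k /andP[kd ck] mink.
have lek l : (l < k)%N -> (ii l < c)%N.
  move=> lk; rewrite ltnNge; apply/negP => h.
  by have := mink l; rewrite h (leq_trans (ltnW lk) kd) /= leqNgt lk => /(_ isT).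
pose e l := if (l < k)%N then ii l else if l == k then val c else ii l.-1.
rewrite -[c]inord_val (socle_mnmE n t ii _ kd).
rewrite -(big_mkord xpredT (fun l => seq_mnm n d (slot_seq t ii l (e l)))).
apply: mon_pow_sum => [|l]; first by rewrite size_iota subn0.
rewrite mem_index_iota ltnS => /= ld.
have [lc cl] : (l * t <= e l)%N /\ (e l <= ii l)%N.
  rewrite /e; have := seq_ge iiS ii0 ld; rewrite mulSn => hl.
  case: (ltngtP l k) => [_|kl|lk]; first by split=> //; lia.
    case: l kl ld {hl} => // l kl ld.
    by have := iiS ld; have := seq_ge iiS ii0 (ltnW ld); rewrite /=; lia.
  rewrite lk; split=> //; case: k kd lek {e ck mink lk} => // k kd lek.
  apply: leq_trans (ltnW (lek k (ltnSn k))).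
  by apply: (seq_ge iiS ii0); apply: ltnW.
apply: seq_mnm_borel_gens => a ad.
  exact: (slot_seq_le iiS ii0).
exact: (slot_seqS iiS).
Qed.

Lemma spread_borel_depth k : (d < k)%N ->
  has_depth (max_ideal K N) (quotmod (ideal_pow I k)) 0.
Proof.
move=> dk; pose w := (socle_mnm n d t ii + u *+ (k - d.+1))%MM.
have uG : u \in G by apply: seq_mnm_borel_gens.
have upow e : mon_pow G e (u *+ e)%MM.
  elim: e => [|e IH]; first exact: mon_pow0.
  by rewrite mulmS -[e.+1]add1n; apply: mon_powD => //; apply: mon_pow1.
apply: (@has_depth0 _ _ _ 'X_[w]).
  (* Monomials of the [k]-th power have degree at least [d.+1 * k], one more than that of [w]. *)
  apply/negP => /(ideal_pow_supp IG)/(_ (_ : w \in _)).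
  rewrite msuppX mem_seq1 eqxx => /(_ isT).
  move=> /(@mon_pow_mwt _ _ (fun=> 1%N) d.+1).
  have hG v : v \in G -> (d.+1 <= mwt (fun=> 1%N) v)%N.
    by rewrite mwt_const => /mdeg_borel_gens ->.
  move=> /(_ hG); rewrite mwt_const mdegD mdegMn mdeg_seq_mnm.
  rewrite -[X in (_ * X <= _)%N](subnKC dk) mulnDr -(mdeg_socle_mnm n d t ii).
  by rewrite addSn ltnn.
move=> x /asboolP[c ->]; rewrite -mpolyXD; apply: (mon_pow_ideal_pow IG).
rewrite addmA -{1}(subnKC dk); apply: mon_powD => //.
exact: socle_mnm_mon_pow.
Qed.

(** Generators are squarefree of degree [d.+1], so their weight away from any one variable is at
    least [d]. *)
Lemma chain_face_is_face m : is_face G (chain_face d ii m).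
Proof.
have leG v e : v \in G -> (d <= mwt (predC1 (e : 'I_N) : pred _) v)%N.
  move=> Gv; have := mwt_predC1 e v; rewrite mdeg_borel_gens //.
  case/asboolP: Gv => tv _ _; have := tspread_le1 t_gt0 tv e; lia.
apply: is_faceI; first exact: is_face_mdeg mdeg_borel_gens.
apply: is_faceI; first by apply: is_face_forall => c; apply: is_face_mwt.
apply: is_faceI.
  by apply: is_face_forall => a; apply: is_face_mwt => v; apply: leG.
split=> [|i j v w _ _]; first by rewrite implybT.
by rewrite addn_eq0; case: (n < m)%N.
Qed.

Lemma spread_borel_analytic_spread : has_analytic_spread I N.
Proof.
split; last by move=> l; apply: (fiber_prime_chain_leq IG _ mdeg_borel_gens).
apply: (face_chain_prime_chain (d := d.+1) IG chain_face_is_face).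
- by move=> m j w /and4P[].
- exact: chain_face_mono.
move=> m /(chain_face_strict iiS ii0 t_gt0 iid)[f [fle fS Qf NQf]].
by exists (seq_mnm n d f); rewrite ?Qf //; apply: seq_mnm_borel_gens.
Qed.

End SpreadBorelIdeal.

(** [tspread] only provides some sequence with the same product. Both sequences are strictly
    increasing with the same entries, so they coincide and the gaps carry over. *)
Lemma tspread_sum_gap (n d t : nat) (i : 'I_d.+1 -> 'I_n) : (1 <= t)%N ->
    {homo i : a b / (a < b)%N} -> tspread t (\sum_(a < d.+1) U_(i a))%MM ->
  forall a, (a < d)%N -> (i (inord a) + t <= i (inord a.+1))%N.
Proof.
move=> t_gt0 homi [s ss sE] a ad.
pose r := mkseq (fun b => i (inord b)) d.+1.
have rE : (\sum_(a < d.+1) U_(i a))%MM = (\sum_(x <- r) U_(x))%MM.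
  by rewrite mnm_sum_mkseq; apply: eq_bigr => a0 _; rewrite inord_val.
have sr : s = r.
  apply: (irr_sorted_eq (@ltn_ord_trans n)) => [x|||c].
  - exact: ltnn.
  - exact: tspread_sorted_lt ss.
  - apply/(sortedP (i ord0)) => b; rewrite size_mkseq => bd.
    by rewrite !nth_mkseq ?(ltnW bd) //; apply: homi; rewrite !inordK // ltnW.
  by rewrite -!has_pred1 !has_count -!mnm_sum1E -sE rE.
have /(sortedP (i ord0))/(_ a) := ss; rewrite sr size_mkseq ltnS => /(_ ad).
by rewrite !nth_mkseq ?ltnS ?(ltnW ad) //; lia.
Qed.

Theorem theorem3p1 (K : fieldType) (n t d : nat) (i : 'I_d -> 'I_n)
    (I : {pred {mpoly K[n]}}) :
  (1 <= t)%N ->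
  (1 <= d)%N ->
  {homo i : a b / (a < b)%N} ->
  (forall a : 'I_d, a = 0%N :> nat -> (t + 1 <= (i a).+1)%N) ->
  (forall a : 'I_d, a.+1 = d -> (i a).+1 = n) ->
  tspread t (\sum_(a < d) U_(i a))%MM ->
  is_tspread_principal_borel t (\sum_(a < d) U_(i a))%MM I ->
  (forall k : nat, (d <= k)%N ->
     has_depth (max_ideal K n)
       (quotmod (ideal_pow I k)) 0) /\
  has_analytic_spread I n.
Proof.
case: d i => [//|d] i t_gt0 _ homi hi0 hid tu borelI.
case: n i I homi hi0 hid tu borelI => [|n] i I homi hi0 hid tu borelI.
  by case: (i ord0).
pose ii a : nat := i (inord a).
have uE : (\sum_(a < d.+1) U_(i a))%MM = seq_mnm n d ii.
  by apply: eq_bigr => a _; rewrite /ii !inord_val.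
have ii0 : (t <= ii 0)%N by have := hi0 (inord 0); rewrite inordK // addn1; apply.
have iid : ii d = n by apply: succn_inj; apply: hid; rewrite inordK.
have iiS := tspread_sum_gap t_gt0 homi tu.
rewrite uE in borelI; split=> [k|].
  exact: (spread_borel_depth t_gt0 ii0 iid iiS).
exact: (spread_borel_analytic_spread t_gt0 ii0 iid iiS).
Qed.
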